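(* Let $X$ be a Polish space, $\rho$ an infinite, diffuse, locally finite measure on $X$, $(Y_t)_{0\le t<1}$ the spatial Chinese restaurant-like process with parameter $\rho$, and $(B_n)_n$ an increasing sequence of bounded Borel sets exhausting $X$ (i.e. $\bigcup_nB_n=X$) with $\rho(B_n)>0$. For bounded Borel $B$ with $\rho(B)>0$ let $$Z_{B,t}(j)=\frac1{\sqrt{\rho(B)}}\Bigl[U_{B,t}(j)-\frac{t^j\rho(B)}{j}\Bigr],\qquad j\in\mathbb N,$$ where $U_{B,t}(j)$ is the number of $x\in B$ with $Y_t(\{x\})=j$. Then for each $t\in(0,1)$ and $j\in\mathbb N$, $Z_{B_n,t}(j)$ converges weakly as $n\to\infty$ to a $\mathcal N(0,\tfrac{t^j}{j})$-distributed random variable $Z_t(j)$. Moreover, the random variables $Z_t(1),Z_t(2),\dots$ (arising as joint weak limit) are independent.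
   Context: $\mathbb N=\{1,2,\dots\}$; $\mathcal N(0,\sigma^2)$ is the normal law with mean $0$ and variance $\sigma^2$. $X$ is a Polish space with its bounded Borel sets; $\mathcal M(X)$ is the space of locally finite measures (finite on bounded sets) with the vague topology, $\mathcal M^{\cdot\cdot}(X)$ its closed subset of point measures. Pólya sum process: for $z\in[0,1)$ and $\kappa\in\mathcal M(X)$, $\mathsf S_{z,\kappa}$ denotes the unique law on $\mathcal M^{\cdot\cdot}(X)$ satisfying, for all measurable $h\ge 0$, $\iint h(x,\mu)\,\mu(\mathrm dx)\,\mathsf S_{z,\kappa}(\mathrm d\mu)=\iint h(x,\mu+\delta_x)\,z(\kappa+\mu)(\mathrm dx)\,\mathsf S_{z,\kappa}(\mathrm d\mu)$. Spatial Chinese restaurant-like process with parameter $\rho\in\mathcal M(X)$: the Markov process $(Y_t)_{0\le t<1}$ with values in $\mathcal M^{\cdot\cdot}(X)$ and càdlàg, increasing paths ($Y_s\le Y_t$ for $s\le t$) such that $Y_0=0$ and, for $0\le s<t<1$, the conditional law of $Y_t-Y_s$ given $Y_s$ is $\mathsf S_{\frac{t-s}{1-s},\,\rho+Y_s}$. *)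

(* Defs.v *)
From HB Require Import structures.
From mathcomp Require Import all_boot all_order all_algebra finmap.
From mathcomp Require Import all_classical all_reals all_analysis.
From mathcomp Require Import measurable_realfun.

Set Implicit Arguments.
Unset Strict Implicit.
Unset Printing Implicit Defensive.

Import Order.TTheory GRing.Theory Num.Theory.
Import numFieldNormedType.Exports.

Local Open Scope classical_set_scope.
Local Open Scope ring_scope.

HB.mixin Record isSeparable T & Topological T := {
  separable : exists2 D : set T, countable D & dense D }.

(* A Polish space comes with a fixed complete separable metric: the notion of
   bounded set, hence of locally finite measure, depends on the metric and not
   only on the topology. *)
#[short(type="polishType")]
HB.structure Definition Polish (R : numDomainType) :=
  { T of CompletePseudoMetric R T & PseudoMetric_isMetric R T & isSeparable T }.

Notation borel T := (g_sigma_algebraType (@open T)).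

Definition metric_bounded (R : numDomainType) (X : metricType R) (B : set X) :=
  exists r : R, forall x y, B x -> B y -> mdist x y <= r.

Section locally_finite_measures.
Context {R : realType} {X : polishType R}.

Definition locally_finite (mu : set (borel X) -> \bar R) :=
  forall B : set (borel X),
    measurable B -> metric_bounded (B : set X) -> (mu B < +oo)%E.

Definition integer_valued (mu : set (borel X) -> \bar R) :=
  forall B : set (borel X), measurable B -> metric_bounded (B : set X) ->
    exists n : nat, mu B = n%:R%:E.

End locally_finite_measures.

Section spaces_of_measures.
Context (R : realType) (X : polishType R).

(* A measure of the library is a function on all sets, and only its values on
   measurable sets are meaningful: two elements of lfmeasure or pmeasure that
   agree on Borel sets need not be equal, but no open set (hence no Borel set)
   of the vague topology below separates them. *)
Record lfmeasure := LFMeasure {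
  lfm_val :> {measure set (borel X) -> \bar R};
  lfm_locally_finite : locally_finite lfm_val }.

Record pmeasure := PMeasure {
  pm_val :> lfmeasure;
  pm_integer_valued : integer_valued pm_val }.

Record vague_test := VagueTest {
  vt_fun :> X -> R;
  vt_continuous : continuous vt_fun;
  vt_ge0 : forall x, 0 <= vt_fun x;
  vt_bounded : exists M : R, forall x, vt_fun x <= M;
  vt_support : metric_bounded [set x | vt_fun x != 0] }.

Definition vague_eval (mu : lfmeasure) : prod_topology (fun _ : vague_test => R) :=
  fun f => (\int[mu]_x f x)%R.

Lemma mzero_locally_finite :
  locally_finite (@mzero _ (borel X) R : {measure set _ -> \bar R}).
Proof. by move=> B _ _; rewrite /mzero ltry. Qed.

Definition lfm0 := LFMeasure mzero_locally_finite.

Lemma lfm0_integer_valued : integer_valued lfm0.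
Proof. by move=> B _ _; exists 0%N. Qed.

Definition pm0 := PMeasure lfm0_integer_valued.

HB.instance Definition _ := gen_eqMixin lfmeasure.
HB.instance Definition _ := gen_choiceMixin lfmeasure.
HB.instance Definition _ := isPointed.Build lfmeasure lfm0.
HB.instance Definition _ :=
  Topological.copy lfmeasure (initial_topology vague_eval).

HB.instance Definition _ := gen_eqMixin pmeasure.
HB.instance Definition _ := gen_choiceMixin pmeasure.
HB.instance Definition _ := isPointed.Build pmeasure pm0.
(* The subspace topology from lfmeasure. *)
HB.instance Definition _ :=
  Topological.copy pmeasure (initial_topology pm_val).

Lemma lfm_add_locally_finite (mu nu : lfmeasure) :
  locally_finite (measure_add mu nu).
Proof.
by move=> B mB bB; rewrite measure_addE lte_add_pinfty//;
  exact: lfm_locally_finite.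
Qed.

Definition lfm_add (mu nu : lfmeasure) := LFMeasure (lfm_add_locally_finite mu nu).

Lemma pm_add_integer_valued (mu nu : pmeasure) : integer_valued (lfm_add mu nu).
Proof.
move=> B mB bB.
have [m mE] := pm_integer_valued mu mB bB.
have [n nE] := pm_integer_valued nu mB bB.
by exists (m + n)%N; rewrite [LHS]measure_addE mE nE natrD EFinD.
Qed.

Definition pm_add (mu nu : pmeasure) := PMeasure (pm_add_integer_valued mu nu).

Lemma dirac_locally_finite (x : X) :
  locally_finite (dirac (x : borel X) : {measure set (borel X) -> \bar R}).
Proof. by move=> B _ _; apply: ltry. Qed.

Lemma dirac_integer_valued (x : X) :
  integer_valued (LFMeasure (dirac_locally_finite x)).
Proof. by move=> B _ _; exists (x \in (B : set X)); exact: diracE. Qed.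

Definition pm_dirac (x : X) := PMeasure (dirac_integer_valued x).

Definition pm_le (mu nu : pmeasure) :=
  forall A : set (borel X), measurable A -> (mu A <= nu A)%E.

(* mu - nu, for nu <= mu: the point measure D with nu + D = mu, unique on Borel
   sets because nu is locally finite. *)
Definition pm_sub (mu nu : pmeasure) : pmeasure :=
  get [set D : pmeasure | forall A : set (borel X), measurable A ->
                            pm_add nu D A = mu A].

End spaces_of_measures.

Arguments pm0 {R X}.

Section polya_sum_process.
Context {R : realType} {X : polishType R}.
Local Open Scope ereal_scope.

(* S is the law S_{z,kappa}; z(kappa + mu)(dx) is written with the scalar z
   outside of the inner integral. *)
Definition polya_sum_law (z : R) (kappa : lfmeasure X)
    (S : {measure set (borel (pmeasure X)) -> \bar R}) :=
  S setT = 1 /\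
  forall h : borel X * borel (pmeasure X) -> \bar R,
    measurable_fun setT h -> (forall p, 0 <= h p) ->
    \int[S]_mu \int[(mu : pmeasure X)]_x h (x, mu) =
    \int[S]_mu (z%:E * \int[lfm_add kappa (mu : pmeasure X)]_x
                          h (x, pm_add mu (pm_dirac x))).

End polya_sum_process.

Section processes.
Context {d : measure_display} {T : measurableType d} {R : realType}
  (P : probability T R).
Local Open Scope ereal_scope.

Definition conditional_law d1 d2
    (E1 : measurableType d1) (E2 : measurableType d2)
    (D : T -> E2) (Y : T -> E1) (K : R.-pker E1 ~> E2) :=
  forall (C : set E1) (A : set E2), measurable C -> measurable A ->
    P (Y @^-1` C `&` D @^-1` A) = \int[P]_(w in Y @^-1` C) K (Y w) A.

Definition natural_filtration d1 (E : measurableType d1) (Y : R -> T -> E)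
    (s : R) : set (set T) :=
  <<s \bigcup_(u in [set u | (0 <= u <= s)%R])
        preimage_set_system setT (Y u) measurable >>.

(* Markov property on the time interval [0, 1): P(Y_t \in A | F_s) has a version
   of the form g(Y_s). *)
Definition markov_process d1 (E : measurableType d1) (Y : R -> T -> E) :=
  forall s t : R, (0 <= s)%R -> (s <= t)%R -> (t < 1)%R ->
  forall A : set E, measurable A ->
  exists g : E -> \bar R,
    [/\ measurable_fun setT g, (forall y, 0 <= g y) &
        forall F : set T, natural_filtration Y s F ->
          P (F `&` Y t @^-1` A) = \int[P]_(w in F) g (Y s w)].

End processes.

Section spatial_chinese_restaurant.
Context {d : measure_display} {T : measurableType d} {R : realType}
  {X : polishType R}.
Local Open Scope ring_scope.

(* Only the values Y t for 0 <= t < 1 matter. *)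
Record spatial_crp (P : probability T R) (rho : lfmeasure X)
    (Y : R -> T -> pmeasure X) : Prop := SpatialCRP {
  scrp_measurable : forall t : R, 0 <= t < 1 ->
    measurable_fun setT (Y t : T -> borel (pmeasure X));
  scrp_markov : markov_process P (Y : R -> T -> borel (pmeasure X));
  scrp_right_continuous : forall w (t : R), 0 <= t < 1 ->
    Y u w @[u --> t^'+] --> Y t w;
  scrp_left_limits : forall w (t : R), 0 < t < 1 ->
    exists l : pmeasure X, Y u w @[u --> t^'-] --> l;
  scrp_increasing : forall w (s t : R), 0 <= s -> s <= t -> t < 1 ->
    pm_le (Y s w) (Y t w);
  scrp_start : forall w, Y 0 w setT = 0%E;
  scrp_increments : forall s t : R, 0 <= s -> s < t -> t < 1 ->
    exists K : R.-pker borel (pmeasure X) ~> borel (pmeasure X),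
      (forall mu : pmeasure X,
         polya_sum_law ((t - s) / (1 - s)) (lfm_add rho mu) (K mu)) /\
      conditional_law P
        (fun w => pm_sub (Y t w) (Y s w) : borel (pmeasure X))
        (Y s : T -> borel (pmeasure X)) K }.

Definition multiplicity_count (mu : pmeasure X) (B : set X) (j : nat) : nat :=
  #|` fset_set [set x | B x /\ mu [set x] = j%:R%:E] |%fset.

Definition normalized_count (rho : lfmeasure X) (Y : R -> T -> pmeasure X)
    (B : set X) (t : R) (j : nat) (w : T) : R :=
  (Num.sqrt (fine (rho B)))^-1 *
  ((multiplicity_count (Y t w) B j)%:R - t ^+ j * fine (rho B) / j%:R).

End spatial_chinese_restaurant.

Section weak_convergence.
Local Open Scope ereal_scope.

Definition random_element d (T : measurableType d) (E : topologicalType)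
    (V : T -> E) := forall U : set E, open U -> measurable (V @^-1` U).

Definition cvg_in_law (R : realType)
    d (T : measurableType d) (P : probability T R)
    d' (T' : measurableType d') (P' : probability T' R)
    (E : topologicalType) (V_ : nat -> T -> E) (V : T' -> E) :=
  [/\ forall n, random_element (V_ n), random_element V &
      forall f : E -> R, continuous f ->
        (exists M : R, forall x, (`|f x| <= M)%R) ->
        'E_P[f \o V_ n] @[n --> \oo] --> 'E_P'[f \o V]].

(* Mutual independence of the real random variables V j, j \in I. *)
Definition mutually_independent (R : realType)
    d (T : measurableType d) (P : probability T R)
    (I : set nat) (V : nat -> T -> R) :=
  forall (J : {fset nat}) (A : nat -> set R), [set` J] `<=` I ->
    (forall j, measurable (A j)) ->
    P (\bigcap_(j in [set` J]) V j @^-1` A j) =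
    \prod_(j <- J) P (V j @^-1` A j).

End weak_convergence.

(* Main.v *)
Require Import Defs.
From HB Require Import structures.
From mathcomp Require Import all_boot all_order all_algebra finmap.
From mathcomp Require Import all_classical all_reals all_analysis.
From mathcomp Require Import measurable_realfun.
From mathcomp Require Import ring lra zify.

(** At time 0 the process is null on Borel sets, so [Y t] follows the law of the
    Polya sum process with parameters [t] and [rho].  Fix a bounded set [B] and
    let [p(b)] be the probability that, for each [j] up to [k], exactly [b_j]
    points of [B] have multiplicity [j].  The integral identity defining the
    Polya sum process is applied to the indicator of the pairs [(x, mu)] such
    that [x] is a point of [B] of multiplicity [i + 1] in [mu] and [mu] has
    prescribed counts.  A unit mass added at a point of multiplicity [i] moves
    this point to multiplicity [i + 1] and changes nothing else; with [e_i] the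
    unit vectors, this gives ([polya_recursion])
      [(i + 1) (b_(i+1) + 1) p(b + e_(i+1)) = t i (b_i + 1) p(b + e_i)]
    for [i > 0], and [(b_1 + 1) p(b + e_1) = t rho(B) p(b)] for [i = 0]: the
    diffuse measure [rho] only charges the points that are not atoms of [mu],
    and [mu] only charges its atoms.  Hence
      [j (b_j + 1) p(b + e_j) = t^j rho(B) p(b)],
    which says that the counts are independent Poisson variables of means
    [t^j rho(B) / j] ([polya_count_law], [crp_count_law]).

    As [B] exhausts the space these means tend to infinity, since
    [rho] is infinite, and it remains to see that a Poisson variable of large
    mean is nearly Gaussian.  Weak convergence depends only on the law of each
    term, so the counts may be replaced by Poisson quantiles evaluated at
    independent uniform variables that do not depend on [n].  The normalized
    Poisson quantiles then converge pointwise to a normal quantile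
    ([poisson_quantile_cvg]), and bounded convergence yields the joint weak limit
    ([cvg_in_law_coupling]), whose coordinates are functions of distinct uniform
    variables and therefore independent.

    The convergence of quantiles follows from that of distribution functions
    ([poisson_cdf_tail_cvg]).  The derivative of the Poisson distribution
    function at [m] with respect to the mean is minus the mass at [m]; for the
    mean [m + sqrt m * v] this is proportional, as a function of [v], to
    [(1 + v / sqrt m) ^ m * exp (- sqrt m * v)], which tends to
    [exp (- v^2 / 2)] and is dominated by [exp (1 - |v| / 2)].  The constant of
    proportionality need not be estimated: it cancels in the quotient of the
    integral over a half line by the total integral.

    The independent uniform variables are read off the binary digits of a
    single one ([unif_seq_joint]). *)

Set Implicit Arguments.
Unset Strict Implicit.
Unset Printing Implicit Defensive.

Import Order.TTheory GRing.Theory Num.Theory.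
Import numFieldNormedType.Exports.

Local Open Scope classical_set_scope.
Local Open Scope ring_scope.

(** * Borel functions on the space of point measures *)

Section lipschitz_approximation.
Context {R : realType} {X : metricType R}.
Implicit Types (G : set X) (n : nat) (x y : X).

(** The largest [n]-Lipschitz function below the indicator of [G].  These functions
    are vague test functions when [G] is bounded, and for [G] open they increase
    to the indicator, so that the mass of [G] is a limit of integrals of test
    functions. *)
Definition lip_indic G n x : R :=
  inf [set (\1_G y : R) + n%:R * mdist x y | y in [set: X]].

Let S G n x := [set (\1_G y : R) + n%:R * mdist x y | y in [set: X]].

Let term_ge0 G n x y : 0 <= (\1_G y : R) + n%:R * mdist x y.
Proof. by rewrite addr_ge0 ?mulr_ge0 ?mdist_ge0 // indicE. Qed.

Let S_nonempty G n x : S G n x !=set0.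
Proof. by exists ((\1_G x : R) + n%:R * mdist x x); exists x. Qed.

Let S_lb G n x : has_lbound (S G n x).
Proof. by exists 0 => _ [y _ <-]; exact: term_ge0. Qed.

Lemma lip_indic_lb G n x y : lip_indic G n x <= (\1_G y : R) + n%:R * mdist x y.
Proof. by apply: (ge_inf (S_lb G n x)); exists y. Qed.

Lemma lip_indic_glb G n x r :
  (forall y, r <= (\1_G y : R) + n%:R * mdist x y) -> r <= lip_indic G n x.
Proof.
by move=> h; apply: (lb_le_inf (S_nonempty G n x)) => _ [y _ <-]; exact: h.
Qed.

Lemma lip_indic_ge0 G n x : 0 <= lip_indic G n x.
Proof. by apply: lip_indic_glb => y; exact: term_ge0. Qed.

Lemma lip_indic_le G n x : lip_indic G n x <= \1_G x.
Proof. by have := lip_indic_lb G n x x; rewrite mdistxx mulr0 addr0. Qed.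

Lemma lip_indic_nd G x m n : (m <= n)%N -> lip_indic G m x <= lip_indic G n x.
Proof.
move=> mn; apply: lip_indic_glb => y; apply: le_trans (lip_indic_lb _ _ _ y) _.
by rewrite lerD2l ler_wpM2r ?mdist_ge0// ler_nat.
Qed.

Lemma lip_indic_lipschitz G n x y :
  `|lip_indic G n x - lip_indic G n y| <= n%:R * mdist x y.
Proof.
have half a b : lip_indic G n a - lip_indic G n b <= n%:R * mdist a b.
  rewrite lerBlDr -lerBlDl; apply: lip_indic_glb => w.
  rewrite lerBlDr; apply: le_trans (lip_indic_lb _ _ _ w) _.
  rewrite -addrA lerD2l -mulrDr ler_wpM2l//.
  by rewrite addrC; exact: metric_triangle.
rewrite ler_norml half andbT lerNl opprB.
by rewrite metric_sym half.
Qed.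

Lemma lip_indic_continuous G n : continuous (lip_indic G n).
Proof.
move=> x; apply/cvgrPdist_le => e e0.
have e1 : 0 < e / n.+1%:R by rewrite divr_gt0.
near=> y.
have : ball x (e / n.+1%:R) y by near: y; exact: nbhsx_ballx.
rewrite ballEmdist/= => xy; apply: le_trans (lip_indic_lipschitz _ _ _ _) _.
apply: (@le_trans _ _ (n.+1%:R * mdist x y)).
  by rewrite ler_wpM2r ?mdist_ge0// ler_nat.
by rewrite mulrC -ler_pdivlMr// ltW.
Unshelve. all: by end_near. Qed.

(** A point of [G] is at distance at least some [e > 0] from the complement, so the
    infimum is 1 as soon as [n * e >= 1]. *)
Lemma lip_indic_cvg G x : open G -> lip_indic G n x @[n --> \oo] --> (\1_G x : R).
Proof.
move=> oG; have [xG|xG] := pselect (G x); last first.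
  have -> : (\1_G x : R) = 0 by rewrite indicE memNset.
  rewrite (_ : (fun n => lip_indic G n x) = cst 0); first exact: cvg_cst.
  apply/funext => n/=; apply/le_anti; rewrite lip_indic_ge0 andbT.
  by apply: le_trans (lip_indic_le _ _ _) _; rewrite indicE memNset.
have -> : (\1_G x : R) = 1 by rewrite indicE mem_set.
have : nbhs x G by move: oG; rewrite openE => /(_ _ xG).
rewrite -nbhs_ballE => -[e /= e0 eG].
apply: cvg_near_cst; near=> n; apply/le_anti/andP; split.
  by apply: le_trans (lip_indic_le _ _ _) _; rewrite indicE mem_set.
apply: lip_indic_glb => y; rewrite indicE.
have [xy|xy] := boolP (y \in G); first by rewrite lerDl mulr_ge0// mdist_ge0.
rewrite add0r; have : e <= mdist x y.
  rewrite leNgt; apply/negP => lte; move/negP: xy; apply; apply/mem_set/eG.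
  by rewrite ballEmdist.
move=> exy; apply: (@le_trans _ _ (n%:R * e)); last by rewrite ler_wpM2l.
rewrite -ler_pdivrMr// div1r.
by near: n; exact: nbhs_infty_ger.
Unshelve. all: by end_near. Qed.

End lipschitz_approximation.

Section borel_of_pmeasure.
Context {R : realType} {X : polishType R}.
Implicit Types (mu : pmeasure X).

Lemma open_borel (A : set X) : open A -> measurable (A : set (borel X)).
Proof. by move=> oA; exact: sub_gen_smallest. Qed.

Lemma closed_borel (A : set X) : closed A -> measurable (A : set (borel X)).
Proof.
move=> cA; rewrite -(setCK A); apply: measurableC; apply: open_borel.
exact: closed_openC.
Qed.

Lemma measurable_singleton (x : X) : measurable ([set x] : set (borel X)).
Proof.
apply: closed_borel; apply: accessible_closed_set1; apply: hausdorff_accessible.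
exact: metric_hausdorff.
Qed.

Lemma metric_bounded_set1 (x : X) : metric_bounded [set x].
Proof. by exists 0 => a b -> ->; rewrite mdistxx. Qed.

Lemma metric_bounded_sub (A C : set X) : A `<=` C -> metric_bounded C ->
  metric_bounded A.
Proof. by move=> AC [r Cr]; exists r => x y /AC Cx /AC; exact: Cr. Qed.

Lemma metric_bounded_ball (x : X) (r : R) : metric_bounded (ball x r).
Proof.
exists (r + r) => a b; rewrite !ballEmdist/= => xa xb.
apply: le_trans (metric_triangle a x b) _.
by rewrite metric_sym lerD// ltW.
Qed.

Lemma open_metric_ball (x : X) (r : R) : open (ball x r).
Proof.
rewrite openE => y; rewrite ballEmdist/= => xy.
apply/nbhs_ballP; exists (r - mdist x y); first by rewrite /= subr_gt0.
move=> w /=; rewrite !ballEmdist/= => yw.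
by apply: le_lt_trans (metric_triangle x y w) _; rewrite -ltrBrDl.
Qed.

Lemma bigcup_ball_nat (x : X) : \bigcup_n ball x n%:R = [set: X].
Proof.
apply/seteqP; split => // y _; exists (Num.bound (mdist x y)) => //=.
by rewrite ballEmdist/= archi_boundP// mdist_ge0.
Qed.

Lemma continuous_borel (f : X -> R) : continuous f ->
  measurable_fun setT (f : borel X -> R).
Proof.
move=> /continuousP cf; apply: (measurability _ (RGenOpens.measurableE R)) => _ [_ [a [b ->] <-]].
by rewrite setTI; apply: open_borel; apply: cf; exact: interval_open.
Qed.

Lemma pm_lt_pinfty mu (A : set X) : measurable (A : set (borel X)) ->
  metric_bounded A -> (mu A < +oo)%E.
Proof. by move=> mA bA; exact: (lfm_locally_finite mu). Qed.

(* The continuity of the projections of a product topology is stated for index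
   types with a decidable equality. *)
HB.instance Definition _ := gen_eqMixin (vague_test X).

(** The integral of a test function is vaguely continuous by the very definition of
    the vague topology. *)
Lemma measurable_pm_test (f : vague_test X) :
  measurable_fun setT (fun mu : borel (pmeasure X) => \int[mu]_x f x : R).
Proof.
apply: (measurability _ (RGenOpens.measurableE R)) => _ [_ [a [b ->] <-]].
rewrite setTI; apply: sub_gen_smallest => /=.
have cf : continuous (fun mu : pmeasure X => vague_eval mu f).
  move=> mu; apply: (@continuous_comp _ _ _ (fun mu : pmeasure X => vague_eval mu)
    (fun g : prod_topology (fun _ : vague_test X => R) => g f)).
    apply: (@continuous_comp _ _ _ (@pm_val R X) (@vague_eval R X)).
      exact: (@initial_continuous (pmeasure X) (lfmeasure X) (@pm_val R X)).
    exact: (@initial_continuous (lfmeasure X) _ (@vague_eval R X)).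
  exact: (@proj_continuous (vague_test X : eqType) (fun _ => R) f).
by move/continuousP : cf; apply; exact: interval_open.
Qed.

Definition lip_indic_test (G : set X) (n : nat) (bG : metric_bounded G) : vague_test X.
Proof.
refine (@VagueTest R X (lip_indic G n) (@lip_indic_continuous _ _ G n)
  (@lip_indic_ge0 _ _ G n) _ _).
  by exists 1 => x; apply: le_trans (lip_indic_le _ _ _) _; rewrite indicE; case: (_ \in _).
apply: metric_bounded_sub bG => x /= /eqP fx0; apply: contrapT => Gx; apply: fx0.
apply/le_anti; rewrite lip_indic_ge0 andbT.
by apply: le_trans (lip_indic_le _ _ _) _; rewrite indicE memNset.
Defined.

Lemma measurable_pm_eval_open (G : set X) : open G -> metric_bounded G ->
  measurable_fun setT (fun mu : borel (pmeasure X) => mu (G : set (borel X)) : \bar R).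
Proof.
move=> oG bG.
pose f (n : nat) (mu : borel (pmeasure X)) := (\int[mu]_x (lip_indic_test n bG x))%:E.
have mG := open_borel oG.
have mf (n : nat) : measurable_fun setT (lip_indic G n : borel X -> R).
  by apply: continuous_borel; exact: lip_indic_continuous.
apply: (@emeasurable_fun_cvg _ _ _ _ f).
  by move=> n; apply/measurable_EFinP; exact: measurable_pm_test.
move=> mu _; rewrite /f.
have -> : (fun n => (\int[mu]_x (lip_indic_test n bG x))%:E) =
    (fun n => \int[mu]_x (lip_indic G n x)%:E)%E.
  apply/funext => n; rewrite /Rintegral fineK//=.
  rewrite ge0_fin_numE; last first.
    by apply: integral_ge0 => x _; rewrite lee_fin lip_indic_ge0.
  apply: (@le_lt_trans _ _ (\int[mu]_x (\1_G x)%:E)%E).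
    apply: ge0_le_integral => //.
    - by move=> x _; rewrite lee_fin lip_indic_ge0.
    - exact/measurable_EFinP.
    - by apply/measurable_EFinP; exact: measurable_indic.
    - by move=> x _; rewrite lee_fin lip_indic_le.
  by rewrite integral_indic// setIT; exact: pm_lt_pinfty.
have -> : mu (G : set (borel X)) = (\int[mu]_x (\1_G x)%:E)%E.
  by rewrite integral_indic// setIT.
have -> : (\int[mu]_x (\1_G x)%:E = \int[mu]_x limn (fun n => (lip_indic G n x)%:E))%E.
  apply: eq_integral => x _; apply/esym/cvg_lim => //.
  by apply/cvg_EFin; [exact: nearW|exact: lip_indic_cvg].
apply: cvg_monotone_convergence => //.
- by move=> n; exact/measurable_EFinP.
- by move=> n x _; rewrite lee_fin lip_indic_ge0.
- by move=> x _ m n mn; rewrite lee_fin; exact: lip_indic_nd.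
Qed.

(** Intersecting with a bounded open set makes the masses finite, so that the sets
    [A] with a measurable evaluation are closed under complement and form a
    Dynkin system. *)
Lemma measurable_pm_evalI (G A : set X) : open G -> metric_bounded G ->
  measurable (A : set (borel X)) ->
  measurable_fun setT (fun mu : borel (pmeasure X) => mu (A `&` G : set (borel X)) : \bar R).
Proof.
move=> oG bG mA; have mG := open_borel oG.
have fin mu (C : set X) : measurable (C : set (borel X)) -> mu (C `&` G) \is a fin_num.
  move=> mC; rewrite ge0_fin_numE//; apply: pm_lt_pinfty.
    exact: measurableI.
  by apply: metric_bounded_sub bG; exact: subIsetr.
move: A mA; apply: (@dynkin_induction _ (borel X) (@open X) (fun A => measurable_fun setT (fun mu : borel (pmeasure X) => mu (A `&` G : set (borel X)) : \bar R))) => //.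
- by move=> A B oA oB; exact: openI.
- by rewrite setTI; exact: measurable_pm_eval_open.
- move=> A oA; apply: measurable_pm_eval_open; first exact: openI.
  by apply: metric_bounded_sub bG; exact: subIsetr.
- move=> A mA mfA.
  have -> : (fun mu : borel (pmeasure X) => mu (~` A `&` G : set (borel X)) : \bar R)
     = (fun mu => mu (setT `&` G : set (borel X)) - mu (A `&` G : set (borel X)))%E.
    apply/funext => mu; rewrite setTI.
    have -> : ~` A `&` G = G `\` (A `&` G).
      by rewrite setDIr setDv setU0 setDE setIC.
    rewrite measureD//; last by apply: pm_lt_pinfty.
      by rewrite setIC -setIA setIid.
    exact: measurableI.
  apply: emeasurable_funB => //; rewrite setTI; exact: measurable_pm_eval_open.
- move=> F mF tF mfF.
  have -> : (fun mu : borel (pmeasure X) => mu (\bigcup_k F k `&` G : set (borel X)) : \bar R)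
     = (fun mu => \sum_(k <oo) mu (F k `&` G : set (borel X)))%E.
    apply/funext => mu; rewrite setI_bigcupl measure_bigcup//=.
    + by apply: eq_eseriesl => k; rewrite in_setT.
    + by move=> k _; exact: measurableI.
    + by apply: trivIset_setIr.
  by apply: ge0_emeasurable_sum => // k mu _.
Qed.

Lemma measurable_pm_eval (A : set (borel X)) : measurable A ->
  measurable_fun setT (fun mu : borel (pmeasure X) => mu A : \bar R).
Proof.
move=> mA; have [[x0 _]|noX] := pselect (exists x : X, True); last first.
  have -> : A = set0 by apply/seteqP; split => // x _; case: noX; exists x.
  rewrite (_ : (fun _ => _) = cst 0%E); first exact: measurable_cst.
  by apply/funext => mu; rewrite measure0.
apply: (@emeasurable_fun_cvg _ _ _ _
    (fun n (mu : borel (pmeasure X)) => mu (A `&` ball (x0 : X) n%:R : set (borel X)))).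
  move=> n; apply: measurable_pm_evalI => //; last exact: metric_bounded_ball.
  exact: open_metric_ball.
move=> mu _.
have AE : A = \bigcup_n (A `&` ball (x0 : X) n%:R).
  by rewrite -setI_bigcupr bigcup_ball_nat setIT.
rewrite {2}AE; apply: nondecreasing_cvg_mu.
- move=> n; apply: measurableI => //; apply: open_borel.
  exact: open_metric_ball.
- by rewrite -AE.
- move=> m n mn; apply/subsetPset; apply: setIS => y; rewrite !ballEmdist/= => h.
  by apply: lt_le_trans h _; rewrite ler_nat.
Qed.

End borel_of_pmeasure.

(** * Atoms of a point measure in a bounded set *)

Section atoms.
Context {R : realType} {X : polishType R}.
Implicit Types (mu : pmeasure X) (B : set X).

Lemma separable_dense_seq (x0 : X) : exists e : nat -> X,
  forall (x : X) (r : R), 0 < r -> exists n, ball (e n) r x.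
Proof.
have [D cD dD] := @separable R X.
have D0 : D !=set0.
  have [x [_ Dx]] : [set: X] `&` D !=set0 by apply: dD; [exists x0|exact: openT].
  by exists x.
have : (D #<= [set: nat])%card by [].
move/pfcard_geP => [D00|[e]]; first by move: D0; rewrite D00 => -[].
exists e => x r r0.
have [y [xy Dy]] : ball x r `&` D !=set0.
  by apply: dD; [exists x; exact: ballxx|exact: open_metric_ball].
have [n _ en] : (e @` [set: nat]) y by have := 'surj_e; apply.
by exists n; rewrite en; exact: ball_sym.
Qed.

Lemma pm_atom_nat mu (x : X) : exists n : nat, mu [set x] = n%:R%:E.
Proof.
exact: (pm_integer_valued mu (measurable_singleton x) (metric_bounded_set1 x)).
Qed.

Definition level_set B j mu : set X := [set x | B x /\ mu [set x] = j%:R%:E].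

Lemma pm_fset (mu : lfmeasure X) (A : {fset X}) :
  (mu [set` A] = \sum_(x <- A) mu [set x])%E.
Proof.
have -> : [set` A] = \bigcup_(x in [set` A]) [set x].
  by rewrite bigcup_imset1 image_id.
rewrite measure_fin_bigcup//=.
- by rewrite fsbig_finite//= set_fsetK.
- by move=> x y _ _ [z [/= -> ->]].
- by move=> x _; exact: measurable_singleton.
Qed.

Section in_bounded_set.
Variable B : set X.
Hypothesis mB : measurable (B : set (borel X)).
Hypothesis bB : metric_bounded B.

(** Every atom has an integer mass, hence a mass at least 1, and [B] has finite
    mass. *)
Lemma atoms_finite mu : finite_set [set x | B x /\ mu [set x] <> 0%E].
Proof.
have [m muB] := pm_integer_valued mu mB bB.
apply: contrapT => /(@infinite_set_fset _ _ m.+1) [A AB mA].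
have : (mu [set` A] <= mu B)%E.
  apply: le_measure; rewrite ?inE//; last by move=> x /AB[].
  have -> : [set` A] = \bigcup_(x in [set` A]) [set x].
    by rewrite bigcup_imset1 image_id.
  by apply: fin_bigcup_measurable => // x _; exact: measurable_singleton.
apply/negP; rewrite -ltNge muB pm_fset.
apply: (@lt_le_trans _ _ (\sum_(x <- A) 1%:E)%E).
  by rewrite sumEFin lte_fin big_const_seq count_predT iter_addr_0 ltr_nat.
rewrite big_seq [leRHS]big_seq; apply: lee_sum => x xA.
have [n nE] := pm_atom_nat mu x; have [_] := AB x xA.
by rewrite nE lee_fin ler1n; case: n {nE}.
Qed.

Lemma level_set_finite j mu : (0 < j)%N -> finite_set (level_set B j mu).
Proof.
move=> j0; apply: sub_finite_set (atoms_finite mu) => x [Bx xj]; split => //.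
rewrite xj => -[] /eqP; rewrite pnatr_eq0; by case: j j0 {xj}.
Qed.

(** Expresses the number of points of multiplicity [j], a cardinal, as a mass: this
    is what makes the counts measurable and gives them a place in the Polya
    identity. *)
Lemma measure_level_set j mu : (0 < j)%N ->
  mu (level_set B j mu) = (j * multiplicity_count mu B j)%:R%:E.
Proof.
move=> j0; have fin := level_set_finite mu j0.
rewrite -(fset_setK fin) pm_fset [LHS]big_seq.
rewrite (eq_bigr (fun=> j%:R%:E)); last first.
  by move=> x xl; have [] : level_set B j mu x by rewrite -(fset_setK fin).
rewrite -big_seq sumEFin big_const_seq count_predT iter_addr_0 /multiplicity_count.
by rewrite mulrnA.
Qed.

Lemma measurable_ballI (x : X) (r : R) : measurable (ball x r `&` B : set (borel X)).
Proof. by apply: measurableI => //; apply: open_borel; exact: open_metric_ball. Qed.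

Lemma cvg_ball_mass mu (x : X) : B x ->
  (fun k => mu (ball x k.+1%:R^-1 `&` B : set (borel X))) @ \oo --> mu [set x].
Proof.
move=> Bx; have xE : [set x] = \bigcap_k (ball x k.+1%:R^-1 `&` B).
  apply/seteqP; split => [y -> k _|y h].
    by split => //; apply: ballxx.
  apply/esym/mdist_positivity/le_anti; rewrite mdist_ge0 andbT.
  apply/ler_addgt0Pl => e e0; rewrite addr0.
  have [+ _] := h (Num.truncn e^-1) Logic.I.
  rewrite ballEmdist/= => /ltW/le_trans; apply.
  rewrite -[leRHS]invrK lef_pV2 ?posrE ?invr_gt0//.
  by rewrite ltW// truncnS_gt.
rewrite [in X in _ --> X]xE; apply: nonincreasing_cvg_mu.
- apply: pm_lt_pinfty; first exact: measurable_ballI.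
  by apply: metric_bounded_sub bB; exact: subIsetr.
- by move=> k; exact: measurable_ballI.
- by rewrite -xE; exact: measurable_singleton.
- move=> m n mn; apply/subsetPset; apply: setSI => y; rewrite !ballEmdist/=.
  by move=> /lt_le_trans; apply; rewrite lef_pV2 ?posrE// ler_nat.
Qed.

(** The masses of the balls shrinking to a point that is not an atom are integers
    that tend to 0, so some ball around it is null; countably many null balls
    suffice. *)
Lemma nonatomic_null mu : mu (level_set B 0 mu) = 0%E.
Proof.
have mE : measurable (level_set B 0 mu : set (borel X)).
  have -> : level_set B 0 mu = B `\` [set x | B x /\ mu [set x] <> 0%E].
    apply/seteqP; split => x; first by move=> [Bx x0]; split => // -[].
    by move=> [Bx h]; split => //; apply: contrapT => x0; apply: h.
  apply: measurableD => //; rewrite -[X in measurable X]image_id -bigcup_imset1.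
  apply: fin_bigcup_measurable; first exact: atoms_finite.
  by move=> x _; exact: measurable_singleton.
have [[x0 _]|noX] := pselect (exists x : X, True); last first.
  have -> : level_set B 0 mu = set0.
    by apply/seteqP; split => // x _; case: noX; exists x.
  exact: measure0.
have [e he] := separable_dense_seq x0.
pose N n k : set (borel X) := [set x : borel X | ball (e n) k.+1%:R^-1 x /\ B x /\
   mu (ball (e n) k.+1%:R^-1 `&` B : set (borel X)) = 0%E].
have N0 : mu.-negligible (\bigcup_n \bigcup_k N n k).
  apply: negligible_bigcup => n; apply: negligible_bigcup => k.
  have [N0|N0] := pselect (mu (ball (e n) k.+1%:R^-1 `&` B : set (borel X)) = 0%E).
    apply: negligibleS (_ : mu.-negligible (ball (e n) k.+1%:R^-1 `&` B)); last first.
      by apply/negligibleP => //; exact: measurable_ballI.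
    by move=> x [? []].
  by apply: negligibleS (negligible_set0 mu) => x [? []].
apply/negligibleP => //; apply: negligibleS N0 => x [Bx x0'].
have [k k0] : exists k : nat, mu (ball x k.+1%:R^-1 `&` B : set (borel X)) = 0%E.
  apply: contrapT => /forallNP h.
  have : (1%:E <= mu [set x])%E.
    have /cvge_to_ge := @cvg_ball_mass mu x Bx; apply; apply: nearW => k.
    have [m mm] : exists m : nat, mu (ball x k.+1%:R^-1 `&` B : set (borel X)) = m%:R%:E.
      apply: pm_integer_valued; first exact: measurable_ballI.
      by apply: metric_bounded_sub bB; exact: subIsetr.
    by rewrite mm lee_fin ler1n lt0n; apply/eqP => m0; apply: (h k); rewrite mm m0.
  by rewrite x0' lee_fin ler10.
have [n xn] := he x (2 * k.+1)%:R^-1 ltac:(by rewrite invr_gt0 ltr0n muln_gt0).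
(* The ball of half the radius around a nearby point of the dense sequence lies in
   the null ball around [x]; the index [2 * k + 1] stands for the radius
   [1 / (2 * (k + 1))]. *)
have E2 : ((2 * k).+1.+1 = 2 * k.+1)%N by lia.
exists n => //; exists (2 * k).+1 => //; rewrite /N/= E2; split => //; split => //.
apply/eqP; rewrite -measure_le0 -k0; apply: le_measure; rewrite ?inE.
- exact: measurable_ballI.
- exact: measurable_ballI.
- move=> y [ny By]; split => //.
  have -> : k.+1%:R^-1 = (2 * k.+1)%:R^-1 + (2 * k.+1)%:R^-1 :> R.
    by rewrite natrM invfM mulrC -splitr.
  by apply: ball_triangle ny; exact: ball_sym.
Qed.

(** [mu] has mass at least [j] at [x] if and only if at every scale some ball of
    countably many contains [x] and has mass at least [j]. *)
Lemma measurable_atom_ge j : measurable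
  [set p : borel (pmeasure X) * borel X | B p.2 /\ (j%:R%:E <= p.1 [set p.2])%E].
Proof.
have [[x0 _]|noX] := pselect (exists x : X, True); last first.
  rewrite (_ : [set _ | _] = set0); first exact: measurable0.
  by apply/seteqP; split => // p _; case: noX; exists p.2.
have [e he] := separable_dense_seq x0.
rewrite (_ : [set _ | _] = (setT `*` B) `&` \bigcap_k \bigcup_n
  ([set mu : borel (pmeasure X) |
     (j%:R%:E <= mu (ball (e n) (2 * k.+1)%:R^-1 `&` B : set (borel X)))%E]
    `*` (ball (e n) (2 * k.+1)%:R^-1 : set (borel X)))).
  apply: measurableI; first by apply: measurableX.
  apply: bigcapT_measurable => k; apply: bigcupT_measurable => n.
  apply: measurableX; last by apply: open_borel; exact: open_metric_ball.
  rewrite -[X in measurable X]setTI; apply: emeasurable_fun_c_infty => //.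
  by apply: measurable_pm_eval; exact: measurable_ballI.
apply/seteqP; split => [[mu x]/= [Bx jx]|[mu x] [[_ /= Bx] h]].
  split => // k _; have [n xn] := he x (2 * k.+1)%:R^-1 ltac:(by rewrite invr_gt0 ltr0n muln_gt0).
  exists n => //; split => //=; apply: le_trans jx _; apply: le_measure; rewrite ?inE.
  + exact: measurable_singleton.
  + exact: measurable_ballI.
  + by move=> _ ->.
split => //=; have /cvge_to_ge := @cvg_ball_mass mu x Bx; apply; apply: nearW => k.
have [n _ [/= jn xn]] := h k Logic.I.
apply: le_trans jn _; apply: le_measure; rewrite ?inE.
- exact: measurable_ballI.
- exact: measurable_ballI.
- move=> y [ny By]; split => //.
  have -> : k.+1%:R^-1 = (2 * k.+1)%:R^-1 + (2 * k.+1)%:R^-1 :> R.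
    by rewrite natrM invfM mulrC -splitr.
  by apply: ball_triangle ny; exact: ball_sym.
Qed.

Lemma measurable_level_graph j : measurable
  [set p : borel (pmeasure X) * borel X | level_set B j p.1 p.2].
Proof.
rewrite (_ : [set _ | _] =
  [set p : borel (pmeasure X) * borel X | B p.2 /\ (j%:R%:E <= p.1 [set p.2])%E] `\`
  [set p : borel (pmeasure X) * borel X | B p.2 /\ (j.+1%:R%:E <= p.1 [set p.2])%E]).
  by apply: measurableD; exact: measurable_atom_ge.
apply/seteqP; split => [[mu x] /= [Bx xj]|[mu x] /= [[Bx jx] h]].
  by split; [rewrite xj|move=> [_]; rewrite xj lee_fin ler_nat ltnn].
split => //; have [m mE] := pm_atom_nat mu x; rewrite mE in jx h *.
congr (_%:R%:E); move: jx h; rewrite !lee_fin !ler_nat => jm h.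
apply/eqP; rewrite eqn_leq jm andbT leqNgt; apply/negP => mj; exact: h.
Qed.

End in_bounded_set.

End atoms.

Section counts.
Context {R : realType} {X : polishType R}.
Implicit Types (mu : pmeasure X).

Lemma pm_add_diracE mu (x : X) (A : set (borel X)) :
  pm_add mu (pm_dirac x) A = (mu A + ((x : borel X) \in A)%:R%:E)%E.
Proof. by rewrite [LHS]measure_addE [X in (_ + X)%E]diracE. Qed.

(** The identity, seen as a kernel: the theory of kernels then provides the
    measurability of [mu] applied to a section of a measurable set that depends
    on [mu]. *)
Definition pm_kernel (mu : borel (pmeasure X)) : {measure set (borel X) -> \bar R} :=
  lfm_val (pm_val mu).

HB.instance Definition _ := isKernel.Build _ _ (borel (pmeasure X)) (borel X) R
  pm_kernel (@measurable_pm_eval R X).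

Variable B : set X.
Hypothesis mB : measurable (B : set (borel X)).
Hypothesis bB : metric_bounded B.

Lemma measurable_count j a : (0 < j)%N ->
  measurable [set mu : borel (pmeasure X) | multiplicity_count mu B j = a].
Proof.
move=> j0.
have mf : measurable_fun setT (fun mu : borel (pmeasure X) =>
    mu (level_set B j mu : set (borel X)) : \bar R).
  have [|_] := @measurable_prod_subset_xsection_kernel _ _ _ _ _ pm_kernel _ mB _
    _ (measurable_level_graph mB bB j).
    move=> mu; exists (fine (mu B) + 1) => A mA.
    rewrite /mrestr; apply: (@le_lt_trans _ _ (mu B)).
      by apply: le_measure; rewrite ?inE//; exact: measurableI.
    have : mu B \is a fin_num.
      by rewrite ge0_fin_numE//; exact: pm_lt_pinfty.
    by move=> fB; rewrite EFinD fineK// lteDl// lte_fin.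
  congr (measurable_fun _ _); apply/funext => mu; rewrite /mrestr.
  congr (pm_kernel mu _); apply/seteqP; split => x.
    by move=> [/xsectionP].
  by move=> h; split; [exact/xsectionP|case: h].
rewrite (_ : [set _ | _] = [set: borel (pmeasure X)] `&`
  (fun mu : borel (pmeasure X) => mu (level_set B j mu : set (borel X))) @^-1` [set (j * a)%:R%:E]).
  exact: mf.
rewrite setTI; apply/seteqP; split => mu /=; rewrite measure_level_set//; first by move=> ->.
by move=> [] /eqP; rewrite eqr_nat eqn_pmul2l// => /eqP.
Qed.

Definition count_event k (b : nat -> nat) : set (pmeasure X) :=
  [set mu | forall j, (0 < j <= k)%N -> multiplicity_count mu B j = b j].

Lemma count_event0 b : count_event 0 b = setT.
Proof. by apply/seteqP; split => // mu _ j; case: j. Qed.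

Lemma measurable_count_event k b :
  measurable (count_event k b : set (borel (pmeasure X))).
Proof.
elim: k => [|k IH]; first by rewrite count_event0.
rewrite (_ : count_event k.+1 b = count_event k b `&` [set mu : borel (pmeasure X) | multiplicity_count mu B k.+1 = b k.+1]).
  by apply: measurableI => //; exact: measurable_count.
apply/seteqP; split => mu.
  move=> h; split => [j /andP[j0 jk]|]; last by apply: h; rewrite /= leqnn.
  by apply: h; rewrite j0 ltnW.
move=> [h1 h2] j /andP[j0]; rewrite leq_eqVlt => /orP[/eqP ->//|jk].
by apply: h1; rewrite j0.
Qed.

Lemma level_set_add_dirac mu x l : 
  level_set B l.+1 (pm_add mu (pm_dirac x)) x <-> level_set B l mu x.
Proof.
rewrite /level_set /= pm_add_diracE mem_set//.
have [n ->] := pm_atom_nat mu x; split=> -[Bx]; last by move=> [->]; rewrite -EFinD natr1.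
by rewrite -EFinD natr1 => -[/eqP]; rewrite eqr_nat eqSS => /eqP ->.
Qed.

(** A unit mass added at a point of level [i] moves it to level [i + 1] and leaves the
    other points in place.  The indicators stand on both sides because
    subtraction of natural numbers is truncated. *)
Lemma count_add_dirac mu x i l : level_set B i mu x -> (0 < l)%N ->
  (multiplicity_count (pm_add mu (pm_dirac x)) B l + (l == i) =
   multiplicity_count mu B l + (l == i.+1))%N.
Proof.
move=> xi l0; set nu := pm_add mu (pm_dirac x).
have other y : y <> x -> (level_set B l nu y <-> level_set B l mu y).
  move=> yx; rewrite /level_set /= pm_add_diracE memNset ?adde0//.
  by move=> xy; apply: yx; rewrite xy.
have fmu := level_set_finite mB bB mu l0.
have fnu := level_set_finite mB bB nu l0.
rewrite /multiplicity_count -/(level_set B l nu) -/(level_set B l mu).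
have xnu : level_set B l nu x <-> l = i.+1.
  case: l l0 other fmu fnu => // l _ _ _ _; split.
    move=> /level_set_add_dirac [_]; have [_ ->] := xi.
    by move=> [/eqP]; rewrite eqr_nat => /eqP ->.
  by move=> [->]; exact/level_set_add_dirac.
have xmu : level_set B l mu x <-> l = i.
  split; last by move=> ->.
  by move=> [_]; have [_ ->] := xi => -[/eqP]; rewrite eqr_nat => /eqP.
have [li|li] := eqVneq l i.
  have -> : (l == i.+1) = false by rewrite li; lia.
  rewrite addn0 (_ : level_set B l mu = x |` level_set B l nu).
    have xN : x \notin level_set B l nu by apply/negP => /set_mem/xnu; rewrite li; lia.
    by rewrite fset_setU1// cardfsU1 in_fset_set// xN add1n addn1.
  apply/seteqP; split => y.
    by have [->|/other h] := pselect (y = x); [left|move/h; right].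
  move=> [->|]; first exact/xmu.
  by have [->|/other h] := pselect (y = x); [move=> _; exact/xmu|move/h].
have [li1|li1] := eqVneq l i.+1.
  rewrite addn0 (_ : level_set B l nu = x |` level_set B l mu).
    have xN : x \notin level_set B l mu.
      by apply/negP => /set_mem/xmu/eqP; rewrite (negbTE li).
    by rewrite fset_setU1// cardfsU1 in_fset_set// xN add1n addn1.
  apply/seteqP; split => y.
    by have [->|/other h] := pselect (y = x); [left|move/h; right].
  move=> [->|]; first exact/xnu.
  by have [->|/other h] := pselect (y = x); [move=> _; exact/xnu|move/h].
congr (#|` fset_set _| + _)%N; apply/seteqP; split => y.
  have [->|/other h] := pselect (y = x); last by move/h.
  by move=> /xnu/eqP; rewrite (negbTE li1).
have [->|/other h] := pselect (y = x); last by move/h.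
by move=> /xmu/eqP; rewrite (negbTE li).
Qed.

(** As [count_event] constrains the entries from 1 on, [add_unit b 0] stands for [b]:
    one statement covers the creation of a point and the growth of its
    multiplicity. *)
Definition add_unit (b : nat -> nat) i : nat -> nat := fun l => (b l + (l == i))%N.

Lemma count_event_add_dirac k b mu x i : level_set B i mu x ->
  count_event k (add_unit b i.+1) (pm_add mu (pm_dirac x)) <->
  count_event k (add_unit b i) mu.
Proof.
move=> xi; split => h l lk; have := h l lk; have /andP[l0 _] := lk;
  have := count_add_dirac xi l0; rewrite /add_unit; lia.
Qed.

Lemma count_event_add_unit0 k b : count_event k (add_unit b 0) = count_event k b.
Proof.
by apply/seteqP; split => mu h l /[dup] lk /andP[l0 _]; rewrite (h _ lk) /add_unit;
  case: l l0 lk => // l _ _; rewrite addn0.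
Qed.

End counts.

(** * Multiplicity counts of a Polya sum process *)

Section polya_recursion.
Context {R : realType} {X : polishType R}.
Implicit Types (mu : pmeasure X).
Variable B : set X.
Hypothesis mB : measurable (B : set (borel X)).
Hypothesis bB : metric_bounded B.

Lemma measurable_level_set j mu : measurable (level_set B j mu : set (borel X)).
Proof.
rewrite (_ : level_set B j mu = xsection
    [set p : borel (pmeasure X) * borel X | level_set B j p.1 p.2] mu).
  by apply: measurable_xsection; exact: measurable_level_graph.
by apply/seteqP; split => x; [move=> ?; exact/xsectionP|move/xsectionP].
Qed.

Lemma diffuse_atoms_null (kappa : lfmeasure X) mu :
  (forall x, kappa [set x] = 0%E) ->
  kappa [set x | B x /\ mu [set x] <> 0%E] = 0%E.
Proof.
move=> kappa0; have fin := atoms_finite mB bB mu.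
by rewrite -(fset_setK fin) pm_fset big1.
Qed.

(** A measure without atoms does not see the finitely many atoms of [mu] in [B]: for
    it, almost every point of [B] has level 0. *)
Lemma diffuse_level_set (kappa : lfmeasure X) mu j :
  (forall x, kappa [set x] = 0%E) ->
  kappa (level_set B j mu) = if j is 0 then kappa B else 0%E.
Proof.
move=> kappa0; have fin := atoms_finite mB bB mu.
have mat : measurable ([set x | B x /\ mu [set x] <> 0%E] : set (borel X)).
  rewrite -[X in measurable X]image_id -bigcup_imset1.
  by apply: fin_bigcup_measurable => // x _; exact: measurable_singleton.
case: j => [|j].
  have BE : B = (B `\` level_set B 0 mu) `|` level_set B 0 mu.
    by rewrite setDKU// => x [].
  rewrite [in RHS]BE measureU//; last 3 first.
  - by apply: measurableD => //; exact: measurable_level_set.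
  - exact: measurable_level_set.
  - by apply/seteqP; split => // x [[_ +] ?]; apply.
  rewrite [X in (X + _)%E](_ : _ = 0%E) ?add0e//.
  apply: etrans (diffuse_atoms_null mu kappa0); congr (kappa _).
  apply/seteqP; split => x [Bx h]; split => //.
    by move=> x0; apply: h.
  by move=> [_ x0]; apply: h.
apply/eqP; rewrite -measure_le0.
apply: le_trans (_ : kappa [set x | B x /\ mu [set x] <> 0%E] <= 0)%E; last first.
  by rewrite diffuse_atoms_null.
apply: le_measure; rewrite ?inE//; first exact: measurable_level_set.
by move=> x [Bx xj]; split => //; rewrite xj => -[] /eqP; rewrite pnatr_eq0.
Qed.

Variables (z : R) (kappa : lfmeasure X) (S : {measure set (borel (pmeasure X)) -> \bar R}).
Hypothesis z0 : 0 <= z.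
Hypothesis kappa_diffuse : forall x, kappa [set x] = 0%E.
Hypothesis S_polya : polya_sum_law z kappa S.

Let ev k b : set (borel (pmeasure X)) := count_event B k b.

Let mev k b : measurable (ev k b).
Proof. exact: measurable_count_event. Qed.

(** The Polya identity for the indicator of the pairs [(x, mu)] with [x] in level
    [i + 1] and [mu] in the event on the left.  On the right hand side
    [mu + delta_x] replaces [mu], and the pair [(x, mu + delta_x)] is selected
    when [x] has level [i] in [mu] and [mu] lies in the event with one more
    point of level [i].  The mass of level [i] for [kappa + mu] comes from
    [kappa] alone if [i = 0] and from [mu] alone if [i > 0]. *)
Lemma polya_recursion k b i : (i < k)%N ->
  ((i.+1 * (b i.+1).+1)%:R%:E * S (count_event B k (add_unit b i.+1)) =
   z%:E * ((if i is 0 then kappa B else (i * (b i).+1)%:R%:E) *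
     S (count_event B k (add_unit b i))))%E.
Proof.
move=> ik.
pose L : set (borel X * borel (pmeasure X)) :=
  [set p | level_set B i.+1 p.2 p.1 /\ ev k (add_unit b i.+1) p.2].
have mL : measurable L.
  rewrite (_ : L = ([set: borel X * borel (pmeasure X)] `&`
    (@unstable.swap (borel X) (borel (pmeasure X))) @^-1`
     [set p : borel (pmeasure X) * borel X | level_set B i.+1 p.1 p.2]) `&`
     (setT `*` ev k (add_unit b i.+1))).
    apply: measurableI; last exact: measurableX.
    by apply: measurable_swap => //; exact: measurable_level_graph.
  apply/seteqP; split => -[x mu] /=; first by move=> [? ?].
  by move=> [[_ ?] [_ ?]].
have [_ /(_ (fun p => (\1_L p)%:E))] := S_polya.
move=> /(_ ltac:(by apply/measurable_EFinP; exact: measurable_indic)).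
move=> /(_ ltac:(by move=> p; rewrite lee_fin indicE)).
have lhs mu : (\int[mu]_x (\1_L (x, mu))%:E =
   (i.+1 * (b i.+1).+1)%:R%:E * (\1_(ev k (add_unit b i.+1)) mu)%:E)%E.
  have [muE|muE] := pselect (ev k (add_unit b i.+1) mu); last first.
    rewrite indicE memNset// mule0 integral0_eq// => x _.
    by rewrite indicE memNset// => -[_].
  rewrite indicE mem_set// mule1.
  transitivity (\int[mu]_x (\1_(level_set B i.+1 mu) x)%:E)%E.
    apply: eq_integral => x _; rewrite !indicE; congr (_%:R%:E); congr nat_of_bool.
    by apply/idP/idP => /set_mem h; apply/mem_set => //; case: h.
  rewrite integral_indic ?setIT//; last exact: measurable_level_set.
  rewrite measure_level_set//; congr (_%:R%:E).
  by rewrite (muE i.+1)// /add_unit eqxx addn1.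
have rhs mu : (\int[lfm_add kappa mu]_x (\1_L (x, pm_add mu (pm_dirac x)))%:E =
   (if i is 0 then kappa B else (i * (b i).+1)%:R%:E) * (\1_(ev k (add_unit b i)) mu)%:E)%E.
  have LE x : L (x, pm_add mu (pm_dirac x)) <-> level_set B i mu x /\ ev k (add_unit b i) mu.
    rewrite /L/=; split => -[].
      move=> /level_set_add_dirac xi h; split => //.
      by apply/(count_event_add_dirac mB bB k b xi).
    move=> xi h; split; first exact/level_set_add_dirac.
    exact/(count_event_add_dirac mB bB k b xi).
  have [muE|muE] := pselect (ev k (add_unit b i) mu); last first.
    rewrite indicE memNset// mule0 integral0_eq// => x _.
    by rewrite indicE memNset// => /LE[].
  rewrite [in RHS]indicE mem_set// mule1.
  transitivity (\int[lfm_add kappa mu]_x (\1_(level_set B i mu) x)%:E)%E.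
    apply: eq_integral => x _; rewrite !indicE; congr (_%:R%:E); congr nat_of_bool.
    by apply/idP/idP => /set_mem h; apply/mem_set => //; [case/LE : h|exact/LE].
  rewrite integral_indic ?setIT//; last exact: measurable_level_set.
  rewrite [LHS]measure_addE diffuse_level_set//.
  case: i ik muE {LE lhs L mL} => [|i] ik muE; first by rewrite nonatomic_null ?adde0.
  rewrite add0e measure_level_set//; congr (_%:R%:E).
  by rewrite (muE i.+1) ?(ltnW ik)// /add_unit eqxx addn1.
under eq_integral do rewrite lhs.
under [in RHS]eq_integral do rewrite rhs.
have c0 : (0 <= if i is 0 then kappa B else (i * (b i).+1)%:R%:E)%E.
  by case: (i) => [|j]; rewrite ?lee_fin.
have mi b' : measurable_fun setT (fun mu : borel (pmeasure X) => (\1_(ev k b') mu : R)%:E).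
  by apply/measurable_EFinP; exact: measurable_indic.
have i0 b' (mu : borel (pmeasure X)) : (0 <= (\1_(ev k b') mu : R)%:E)%E.
  by rewrite lee_fin indicE.
have Zl b' c : (0 <= c)%E -> (\int[S]_mu (c * (\1_(ev k b') mu : R)%:E) = c * S (ev k b'))%E.
  move=> c0'; rewrite ge0_integralZl//.
  by rewrite integral_indic// setIT.
rewrite Zl// ge0_integralZl ?lee_fin//; last 2 first.
- by apply: measurable_funeM; exact: mi.
- by move=> mu _; rewrite mule_ge0.
by rewrite Zl.
Qed.

End polya_recursion.

Section poisson_facts.
Context {R : realType}.

Lemma poisson_pmfE (l : R) m : 0 < l ->
  poisson_pmf l m = l ^+ m / m`!%:R * expR (- l).
Proof. by rewrite /poisson_pmf => ->. Qed.

Lemma poisson_pmf_sum1 (l : R) : 0 < l ->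
  (\sum_(m <oo) (poisson_pmf l m)%:E = 1)%E.
Proof.
move=> l0; have := probability_setT (poisson_prob l 0%N).
rewrite /= /poisson_prob l0 => <-; rewrite nneseries_esumT// => m.
by rewrite lee_fin poisson_pmf_ge0.
Qed.

Lemma poisson_pmfS (l : R) m : 0 < l ->
  m.+1%:R * poisson_pmf l m.+1 = l * poisson_pmf l m.
Proof.
move=> l0; rewrite !poisson_pmfE// exprS factS natrM.
have m0 : m.+1%:R != 0 :> R by rewrite pnatr_eq0.
have f0 : m`!%:R != 0 :> R by rewrite pnatr_eq0 -lt0n fact_gt0.
move: (m.+1%:R) (m`!%:R) m0 f0 => a c a0 c0.
by field; rewrite ?a0 ?c0.
Qed.

End poisson_facts.

Section polya_counts.
Context {R : realType} {X : polishType R}.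
Implicit Types (mu : pmeasure X).
Variable B : set X.
Hypothesis mB : measurable (B : set (borel X)).
Hypothesis bB : metric_bounded B.

Variables (z : R) (kappa : lfmeasure X) (S : {measure set (borel (pmeasure X)) -> \bar R}).
Hypothesis z0 : 0 < z.
Hypothesis kappa_diffuse : forall x, kappa [set x] = 0%E.
Hypothesis kappaB : (0 < kappa B)%E.
Hypothesis S_polya : polya_sum_law z kappa S.

Let beta := fine (kappa B).

Let kappaBE : kappa B = beta%:E.
Proof.
by rewrite fineK// ge0_fin_numE//; exact: (lfm_locally_finite kappa).
Qed.

Let beta_gt0 : 0 < beta.
Proof. by rewrite -lte_fin -kappaBE. Qed.

Let p k b := fine (S (count_event B k b)).

Let pE k b : S (count_event B k b) = (p k b)%:E.
Proof.
rewrite fineK// ge0_fin_numE//; apply: (@le_lt_trans _ _ (S setT)).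
  by apply: le_measure; rewrite ?inE//; exact: measurable_count_event.
by have [-> _] := S_polya; rewrite ltry.
Qed.

(** Iterating the recursion down to level 0 leaves, for each level, the identity that
    characterizes a Poisson variable of mean [z ^ j * kappa B / j]. *)
Lemma polya_count_identity k b j : (0 < j <= k)%N ->
  (j * (b j).+1)%:R * p k (add_unit b j) = z ^+ j * beta * p k b.
Proof.
case: j => // j; elim: j => [|j IH] jk.
  have := polya_recursion mB bB (ltW z0) kappa_diffuse S_polya b jk.
  rewrite kappaBE count_event_add_unit0 !pE -!EFinM => -[->].
  by rewrite expr1 mulrA.
have := polya_recursion mB bB (ltW z0) kappa_diffuse S_polya b jk.
rewrite !pE -!EFinM => -[->]; rewrite IH; last by lia.
by rewrite [in RHS]exprS !mulrA.
Qed.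

Let rate j : R := z ^+ j * beta / j%:R.

Let rate_gt0 j : (0 < j)%N -> 0 < rate j.
Proof. by move=> j0; rewrite divr_gt0 ?ltr0n// mulr_gt0// exprn_gt0. Qed.

Let upd (b : nat -> nat) j m : nat -> nat := fun l => if l == j then m else b l.

(* The count of level [k + 1] enters the joint law as a Poisson mass function. *)
Let p_upd k b m :
  p k.+1 (upd b k.+1 m) = poisson_pmf (rate k.+1) m * (expR (rate k.+1) * p k.+1 (upd b k.+1 0)).
Proof.
have r0 : 0 < rate k.+1 by exact: rate_gt0.
elim: m => [|m IH].
  by rewrite poisson_pmfE// expr0 fact0 divr1 mul1r mulrA -expRD addNr expR0 mul1r.
have -> : upd b k.+1 m.+1 = add_unit (upd b k.+1 m) k.+1.
  by apply/funext => l; rewrite /upd /add_unit; case: eqP => _; lia.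
have := @polya_count_identity k.+1 (upd b k.+1 m) k.+1; rewrite ltnS leqnn => /(_ isT).
rewrite {1}/upd eqxx IH natrM => h.
have k0 : k.+1%:R != 0 :> R by rewrite pnatr_eq0.
have m0 : m.+1%:R != 0 :> R by rewrite pnatr_eq0.
apply: (mulfI m0); apply: (mulfI k0); rewrite mulrA h.
rewrite [X in _ = _ * X]mulrA poisson_pmfS// !mulrA; congr (_ * _ * _ * _).
rewrite /rate; clear h; move: (k.+1%:R) k0 (z ^+ _) => c c0 w; by field.
Qed.

(* Summing over all values of the last count gives the law of the others, because a
   Poisson mass function has total mass 1. *)
Let p_step k b : p k.+1 b = poisson_pmf (rate k.+1) (b k.+1) * p k b.
Proof.
have -> : p k b = expR (rate k.+1) * p k.+1 (upd b k.+1 0).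
  apply/EFin_inj; rewrite -pE.
  have -> : count_event B k b = \bigcup_m count_event B k.+1 (upd b k.+1 m).
    apply/seteqP; split => mu.
      move=> h; exists (multiplicity_count mu B k.+1) => // j jk.
      rewrite /upd; case: eqP => [->//|jk1]; apply: h; lia.
    move=> [m _ h] j jk; rewrite h /upd; last by lia.
    by case: eqP => // jk1; lia.
  rewrite measure_bigcup//=; last 2 first.
  - by move=> m _; exact: measurable_count_event.
  - move=> m n _ _ [mu []] /(_ k.+1) + /(_ k.+1).
    by rewrite leqnn /upd eqxx => /(_ isT) -> /(_ isT).
  rewrite (eq_eseriesr (g := fun m => (expR (rate k.+1) * p k.+1 (upd b k.+1 0))%:E * (poisson_pmf (rate k.+1) m)%:E)%E); last first.
    by move=> m _; rewrite pE p_upd EFinM muleC.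
  under eq_eseriesl do rewrite in_setT.
  rewrite nneseriesZl.
  - by rewrite poisson_pmf_sum1 ?mule1// rate_gt0.
  - by move=> m _; rewrite lee_fin poisson_pmf_ge0.
rewrite -p_upd; congr p; apply/funext => l; rewrite /upd.
by case: eqP => // ->.
Qed.

Lemma polya_count_law k b : S (count_event B k b) =
  (\prod_(i < k) poisson_pmf (z ^+ i.+1 * fine (kappa B) / i.+1%:R) (b i.+1))%:E.
Proof.
rewrite pE; congr EFin; elim: k => [|k IH].
  by rewrite big_ord0 /p count_event0; have [-> _] := S_polya.
by rewrite big_ord_recr/= -IH p_step mulrC.
Qed.

End polya_counts.

(** * Multiplicity counts of the restaurant process *)

Section crp_counts.
Context {R : realType} {X : polishType R} {d : measure_display}
  {T : measurableType d} (P : probability T R).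
Variables (rho : lfmeasure X) (Y : R -> T -> pmeasure X).
Hypothesis rho_diffuse : forall x, rho [set x] = 0%E.
Hypothesis Y_scrp : spatial_crp P rho Y.
Variable t : R.
Hypothesis t01 : 0 < t < 1.

Lemma scrp_start_null w (A : set (borel X)) : measurable A -> Y 0 w A = 0%E.
Proof.
move=> mA; apply/eqP; rewrite -measure_le0.
apply: le_trans (_ : Y 0 w setT <= 0)%E; first by apply: le_measure; rewrite ?inE.
by rewrite (scrp_start Y_scrp).
Qed.

(** A difference of measures is only some solution [D] of [Y 0 w + D = Y t w]; as
    [Y 0 w] is null, every solution agrees with [Y t w] on Borel sets. *)
Lemma pm_sub_start w (A : set (borel X)) : measurable A ->
  pm_sub (Y t w) (Y 0 w) A = Y t w A.
Proof.
move=> mA.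
have start0 (D : pmeasure X) (C : set (borel X)) : measurable C ->
    pm_add (Y 0 w) D C = D C.
  by move=> mC; rewrite [LHS]measure_addE scrp_start_null// add0e.
have : [set D : pmeasure X | forall C : set (borel X), measurable C ->
    pm_add (Y 0 w) D C = Y t w C] (pm_sub (Y t w) (Y 0 w)).
  by apply: getPex; exists (Y t w) => C mC; exact: start0.
by move=> /(_ A mA); rewrite start0.
Qed.

Variable B : set X.
Hypothesis mB : measurable (B : set (borel X)).
Hypothesis bB : metric_bounded B.
Hypothesis rhoB : (0 < rho B)%E.

Lemma measurable_crp_count j a : (0 < j)%N ->
  measurable [set w | multiplicity_count (Y t w) B j = a].
Proof.
move=> j0; have /andP[t0 t1] := t01.
have := scrp_measurable Y_scrp (t := t); rewrite (ltW t0) t1 => /(_ isT).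
move=> /(_ measurableT _ (measurable_count mB bB a j0)).
by rewrite setTI.
Qed.

(** The increment from time 0 is [Y t] itself, and the conditional law given [Y 0] is
    a constant law since [rho + Y 0] agrees with [rho] on Borel sets. *)
Lemma crp_count_law k (b : nat -> nat) :
  P [set w | forall i, (i < k)%N -> multiplicity_count (Y t w) B i.+1 = b i] =
  (\prod_(i < k) poisson_pmf (t ^+ i.+1 * fine (rho B) / i.+1%:R) (b i))%:E.
Proof.
have /andP[t0 t1] := t01.
have [K [K_polya K_law]] := scrp_increments Y_scrp (lexx 0) t0 t1.
(* [count_event] numbers the counts from 1 and [b] from 0. *)
have := K_law setT _ measurableT (measurable_count_event mB bB k (b \o predn)).
rewrite preimage_setT setTI.
have -> : (fun w => pm_sub (Y t w) (Y 0 w) : borel (pmeasure X)) @^-1`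
    (count_event B k (b \o predn)) =
  [set w | forall i, (i < k)%N -> multiplicity_count (Y t w) B i.+1 = b i].
  have E w j : multiplicity_count (pm_sub (Y t w) (Y 0 w)) B j =
      multiplicity_count (Y t w) B j.
    rewrite /multiplicity_count; congr (#|` fset_set _|); apply/seteqP.
    by split => x /= [Bx]; rewrite pm_sub_start; first [exact: measurable_singleton | by move=> xj; split].
  apply/seteqP; split => w /= h i ik.
    by rewrite -E (h i.+1).
  by rewrite E; case: i ik => // i ik; exact: h.
move=> ->.
transitivity (\int[P]_w (\prod_(i < k) poisson_pmf (t ^+ i.+1 * fine (rho B) / i.+1%:R) (b i))%:E)%E.
  apply: eq_integral => w _.
  have := K_polya (Y 0 w); rewrite !subr0 divr1 => Kw.
  have kE : lfm_add rho (Y 0 w) B = rho B.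
    by rewrite [LHS]measure_addE scrp_start_null// adde0.
  rewrite (polya_count_law mB bB t0 _ _ Kw) ?kE//.
  move=> x; rewrite [LHS]measure_addE rho_diffuse scrp_start_null ?adde0//.
  exact: measurable_singleton.
by rewrite integral_cst//= (@probability_setT _ _ _ P) mule1.
Qed.

End crp_counts.

(** * Gaussian limit of the Poisson distribution function *)

Section poisson_tail.
Context {R : realType}.
Implicit Types (m k : nat) (y v s : R).

Let eq_ler (x y : R) : x = y -> x <= y. Proof. by move=> ->. Qed.

(** The Poisson distribution function at [m], as a function of the mean [y].  The
    explicit formula is smooth on the whole line, whereas the mass function
    [poisson_pmf] takes a conventional value at nonpositive means. *)
Definition poisson_cdf m y : R := \sum_(k < m.+1) (y ^+ k / k`!%:R * expR (- y)).

(** The derivative of each summand is the previous one minus itself, so the sum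
    telescopes. *)
Lemma is_derive_poisson_cdf m y :
  is_derive y 1 (poisson_cdf m) (- (y ^+ m / m`!%:R * expR (- y))).
Proof.
elim: m => [|m IH].
  have -> : poisson_cdf 0 = (fun y => expR (- y)).
    by apply/funext => x; rewrite /poisson_cdf big_ord1 expr0 fact0 divr1 mul1r.
  rewrite expr0 fact0 divr1 mul1r; apply: is_derive_eq.
  by rewrite mulrN1.
have -> : poisson_cdf m.+1 = poisson_cdf m +
    (fun y => y ^+ m.+1) * cst (m.+1`!%:R^-1) * (fun y => expR (- y)).
  by apply/funext => x; rewrite /poisson_cdf big_ord_recr.
have f0 : m`!%:R != 0 :> R by rewrite pnatr_eq0 -lt0n fact_gt0.
have m0 : m.+1%:R != 0 :> R by rewrite pnatr_eq0.
have dX : is_derive y 1 (fun y0 : R => y0 ^+ m.+1) (m.+1%:R * y ^+ m).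
  have := @is_deriveX R R^o id m.+1 y 1 1 _.
  by rewrite exprfctE /= => /(_ (is_derive_id _ _)) h; apply: (is_derive_eq h); rewrite [LHS]mulr1.
have dE : is_derive y 1 (fun y0 : R => expR (- y0)) (- expR (- y)).
  by apply: is_derive_eq; rewrite mulrN1.
have D := is_deriveD IH
  (is_deriveM (is_deriveM dX (is_derive_cst (m.+1`!%:R^-1 : R) y 1)) dE).
apply: (is_derive_eq D).
rewrite /GRing.scale/= factS natrM.
move: (m`!%:R) f0 (m.+1%:R) m0 => c c0 a a0.
rewrite mulrfctE /= !exprS; by field; rewrite ?c0 ?a0.
Qed.

(** [y ^ k * exp (- y)] is at most [(k + 1)! / y]. *)
Lemma poisson_cdf_cvgy m : poisson_cdf m y @[y --> +oo] --> 0.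
Proof.
rewrite /poisson_cdf; elim: m.+1 => [|k IH].
  by under eq_fun do rewrite big_ord0; exact: cvg_cst.
under eq_fun do rewrite big_ord_recr/=.
rewrite -[nbhs 0](congr1 nbhs (addr0 (0 : R))); apply: cvgD; first exact: IH.
apply/cvgr0Pnorm_le => e e0; near=> y.
have y0 : 0 < y by near: y; exact: nbhs_pinfty_gt.
have f0 : 0 < k`!%:R :> R by rewrite ltr0n fact_gt0.
rewrite ger0_norm; last first.
  by rewrite /= mulr_ge0 ?expR_ge0// divr_ge0 ?exprn_ge0// ltW.
rewrite expRN ler_pdivrMr ?expR_gt0//.
have h := expR_ge1Dxn k (ltW y0).
have k0 : 0 < k.+1%:R :> R by rewrite ltr0n.
apply: (@le_trans _ _ (k.+1%:R / y * (y ^+ k.+1 / k.+1`!%:R))).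
  apply: eq_ler; rewrite factS natrM exprS.
  move: (k`!%:R) f0 (k.+1%:R) k0 => c c0 a a0.
  by field; rewrite !lt0r_neq0.
have ky : k.+1%:R / y <= e.
  by rewrite ler_pdivrMr// mulrC -ler_pdivrMr//.
apply: ler_pM ky _; first by rewrite divr_ge0// ltW.
  by rewrite divr_ge0// exprn_ge0// ltW.
by apply: le_trans h; rewrite lerDr.
Unshelve. all: by end_near. Qed.

(** For [s ^ 2 = m], the derivative in [v] of the Poisson distribution function with
    mean [s ^ 2 + s * v], up to sign and a factor independent of [v]. *)
Definition tilt s m v : R := (1 + v / s) ^+ m * expR (- (s * v)).

Let ge0_1Ddiv s v : 0 < s -> - s <= v -> 0 <= 1 + v / s.
Proof.
move=> s0 sv; have -> : 1 + v / s = (s + v) / s by field; rewrite lt0r_neq0.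
by apply: divr_ge0; lra.
Qed.

(** The logarithm of the tilt is concave in [v]; the bound has the slope of
    its tangent at [a], and the value 0 there since the tilt is at most 1. *)
Lemma tilt_le_exp s m v a : s ^+ 2 = m%:R -> 0 < s -> - s <= v -> - s < a ->
  tilt s m v <= expR (- ((v - a) * (s * a / (s + a)))).
Proof.
move=> sm s0 sv sa; have sa0 : 0 < s + a by lra.
have v0 := ge0_1Ddiv s0 sv.
have h1 : 1 + v / s <= expR (a / s + (v - a) / (s + a)).
  have -> : 1 + v / s = (1 + a / s) * (1 + (v - a) / (s + a)).
    by field; rewrite !lt0r_neq0.
  rewrite expRD; apply: ler_pM; rewrite ?expR_ge1Dx//; first exact/ge0_1Ddiv/ltW.
  have -> : 1 + (v - a) / (s + a) = (s + v) / (s + a).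
    by field; rewrite lt0r_neq0.
  by apply: divr_ge0; lra.
rewrite /tilt; apply: (@le_trans _ _ (expR (a / s + (v - a) / (s + a)) ^+ m * expR (- (s * v)))).
  by rewrite ler_pM2r ?expR_gt0// lerXn2r// nnegrE ?expR_ge0.
rewrite -expRM_natl -expRD ler_expR -sm.
by apply: eq_ler; field; rewrite !lt0r_neq0.
Qed.

(** The tangents at 1 and -1 bound the two tails, and the tangent at 0 bounds the tilt
    by 1 between them. *)
Lemma tilt_le s m v : s ^+ 2 = m%:R -> 1 < s -> - s <= v ->
  tilt s m v <= expR (1 - `|v| / 2).
Proof.
move=> sm s1 sv; have s0 : 0 < s by lra.
have [v0|v0] := leP 0 v.
  have [v1|v1] := leP 1 v.
    apply: le_trans (tilt_le_exp sm s0 sv (_ : - s < 1)) _; first by lra.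
    rewrite ler_expR mulr1 ger0_norm//.
    have : 1 / 2 <= s / (s + 1) by rewrite ler_pdivlMr; lra.
    by move: (s / (s + 1)) => q; nra.
  apply: le_trans (tilt_le_exp sm s0 sv (_ : - s < 0)) _; first by lra.
  by rewrite ler_expR ger0_norm// !(mulr0, mul0r) oppr0; lra.
have [v1|v1] := leP v (-1).
  apply: le_trans (tilt_le_exp sm s0 sv (_ : - s < -1)) _; first by lra.
  rewrite ler_expR ltr0_norm//.
  have -> : s * (-1) / (s + -1) = - (s / (s - 1)) by rewrite mulrN1 mulNr.
  have : 1 <= s / (s - 1) by rewrite ler_pdivlMr; lra.
  by move: (s / (s - 1)) => q; nra.
apply: le_trans (tilt_le_exp sm s0 sv (_ : - s < 0)) _; first by lra.
by rewrite ler_expR ltr0_norm// !(mulr0, mul0r) oppr0; lra.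
Qed.

Lemma tilt_ge0 s m v : 0 < s -> - s <= v -> 0 <= tilt s m v.
Proof.
by move=> s0 sv; rewrite mulr_ge0 ?expR_ge0// exprn_ge0// ge0_1Ddiv.
Qed.

End poisson_tail.

Section poisson_tail_integral.
Context {R : realType}.
Implicit Types (m k : nat) (v s a : R).
Notation mu := lebesgue_measure.

Definition tilt_const s m : R := s * ((s ^+ 2) ^+ m / m`!%:R * expR (- s ^+ 2)).

Lemma tilt_const_gt0 s m : 0 < s -> 0 < tilt_const s m.
Proof.
move=> s0; rewrite mulr_gt0// mulr_gt0 ?expR_gt0// divr_gt0 ?exprn_gt0//.
Qed.

Lemma is_derive_poisson_cdf_affine s m v : 0 < s ->
  is_derive v 1 (fun v => - poisson_cdf m (s ^+ 2 + s * v)) (tilt_const s m * tilt s m v).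
Proof.
move=> s0.
have dA : is_derive v 1 (fun v : R => s ^+ 2 + s * v) s.
  have -> : (fun v : R => s ^+ 2 + s * v) = cst (s ^+ 2) + s \*: id by [].
  apply: (is_derive_eq (is_deriveD (is_derive_cst (s ^+ 2 : R) v 1)
    (is_deriveZ s (is_derive_id v 1)))).
  by rewrite add0r /GRing.scale/= mulr1.
have D := is_deriveN (@is_derive1_comp R (poisson_cdf m) (fun v => s ^+ 2 + s * v)
  v _ _ (is_derive_poisson_cdf m (s ^+ 2 + s * v)) dA).
apply: (is_derive_eq D).
rewrite mulNr opprK /tilt_const /tilt.
have -> : s ^+ 2 + s * v = s ^+ 2 * (1 + v / s) by field; rewrite lt0r_neq0.
rewrite exprMn mulrDr mulr1.
have -> : s ^+ 2 * (v / s) = s * v by field; rewrite lt0r_neq0.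
rewrite opprD expRD.
have : m`!%:R != 0 :> R by rewrite pnatr_eq0 -lt0n fact_gt0.
move: (m`!%:R) ((1 + v / s) ^+ m) ((s ^+ 2) ^+ m) (expR _) (expR _) => c w z e1 e2 c0.
by field.
Qed.

Lemma poisson_cdf_affine_cvgy s m : 0 < s ->
  - poisson_cdf m (s ^+ 2 + s * v) @[v --> +oo] --> 0.
Proof.
move=> s0; rewrite -oppr0; apply: cvgN.
apply: (@cvg_comp _ _ _ (fun v : R => s ^+ 2 + s * v) (poisson_cdf m)); last exact: poisson_cdf_cvgy.
apply/cvgryPge => A; near=> v.
by rewrite -lerBlDl mulrC -ler_pdivrMr//.
Unshelve. all: by end_near. Qed.

Lemma continuous_tilt s m : continuous (tilt s m).
Proof.
move=> v; apply: cvgM.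
  apply: (@cvg_comp _ _ _ (fun v => 1 + v / s) (fun x => x ^+ m)); last exact: exprn_continuous.
  by apply: cvgD; [exact: cvg_cst|apply: cvgM; [exact: cvg_id|exact: cvg_cst]].
apply: (@cvg_comp _ _ _ (fun v => - (s * v)) expR); last exact: continuous_expR.
by apply: cvgN; apply: cvgM; [exact: cvg_cst|exact: cvg_id].
Qed.

Lemma integral_tilt s m a : 0 < s -> - s <= a ->
  (\int[mu]_(v in `[a, +oo[) (tilt s m v)%:E =
   (poisson_cdf m (s ^+ 2 + s * a) / tilt_const s m)%:E)%E.
Proof.
move=> s0 sa; have c0 := tilt_const_gt0 m s0.
have : (\int[mu]_(v in `[a, +oo[) (tilt_const s m * tilt s m v)%:E =
   (0 : R)%:E - (- poisson_cdf m (s ^+ 2 + s * a))%:E)%E.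
  apply: (@ge0_continuous_FTC2y _ _ (fun v => - poisson_cdf m (s ^+ 2 + s * v))).
  - by move=> v av; rewrite mulr_ge0 ?(ltW c0)// tilt_ge0// (le_trans sa).
  - apply: continuous_subspaceT => v; apply: cvgM; first exact: cvg_cst.
    exact: continuous_tilt.
  - exact: poisson_cdf_affine_cvgy.
  - by move=> v _; apply: ex_derive; exact: is_derive_poisson_cdf_affine.
  - apply: cvg_at_right_filter.
    have /derivable1_diffP/differentiable_continuous :=
      @ex_derive _ _ _ _ _ _ _ (is_derive_poisson_cdf_affine m a s0).
    exact.
  - move=> v _; rewrite derive1E; apply: derive_val.
    exact: is_derive_poisson_cdf_affine.
under eq_integral do rewrite EFinM.
rewrite ge0_integralZl//=; last 3 first.
- apply/measurable_EFinP; apply: measurable_funTS.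
  by apply: continuous_measurable_fun; exact: continuous_tilt.
- by move=> v /=; rewrite in_itv/= andbT => av; rewrite lee_fin tilt_ge0// (le_trans sa).
- by rewrite lee_fin ltW.
rewrite -EFinB sub0r opprK => h.
rewrite -[LHS]mul1e -[in LHS](mulVf (lt0r_neq0 c0)) EFinM -muleA h -EFinM.
by rewrite mulrC.
Qed.

End poisson_tail_integral.

Section gaussian_limit.
Context {R : realType}.
Implicit Types (m n k : nat) (v u a : R).
Notation mu := lebesgue_measure.

Lemma ln1D_second_order : (ln (1 + u) - u) / u ^+ 2 @[u --> (0 : R)^'] --> - (2^-1 : R).
Proof.
pose nz u : R := if u == 0 then 1 else u.
have nz0 u : nz u != 0 by rewrite /nz; case: ifPn => // _; exact: oner_neq0.
have nzE u : u \in `](-2^-1 : R), 2^-1[ `\ 0 -> nz u = u /\ 0 < 1 + u.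
  rewrite inE => -[/=]; rewrite in_itv/= => /andP[u1 u2] u0.
  by rewrite /nz ifN; [split => //; lra|apply/eqP].
apply: (@lhopital R (fun u => ln (1 + u) - u) (fun u => - (nz u / (1 + u)))
  (fun u => u ^+ 2) (fun u => 2 * nz u) (- 2^-1) 2^-1 0).
- by rewrite in_itv/=; lra.
- move=> u /nzE[-> u1].
  have dA : is_derive u 1 (fun u : R => 1 + u) 1.
    by apply: (is_derive_eq (is_deriveD (is_derive_cst (1 : R) u 1) (is_derive_id u 1))); rewrite add0r.
  have D := is_deriveB (@is_derive1_comp R (@ln R) (fun u => 1 + u) u _ _ (is_derive1_ln u1) dA) (is_derive_id u 1).
  by apply: (is_derive_eq D); rewrite mulr1; field; rewrite lt0r_neq0.
- move=> u /nzE[-> u1].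
  have := @is_deriveX R R^o id 2 u 1 1 _.
  by rewrite exprfctE /= => /(_ (is_derive_id _ _)) h; apply: (is_derive_eq h); rewrite [LHS]mulr1.
- have h : (fun u : R => ln (1 + u) - u) u @[u --> (0 : R)] --> ln (1 + 0) - (0 : R).
    apply: cvgB; last exact: cvg_id.
    apply: (@cvg_comp _ _ _ (fun u : R => 1 + u) (@ln R) _ (nbhs (1 + 0 : R))).
      by apply: cvgD; [exact: cvg_cst|exact: cvg_id].
    by apply: continuous_ln; rewrite addr0.
  by rewrite addr0 ln1 subr0 in h.
- by have h := @exprn_continuous R 2 0; rewrite /continuous_at expr0n in h.
- by move=> u _; rewrite mulf_neq0.
have -> : (fun u => - (nz u / (1 + u)) / (2 * nz u)) = (fun u => - ((2 : R)^-1 * (1 + u)^-1)).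
  apply/funext => u; rewrite mulNr.
  have := nz0 u; move: (nz u) ((1 + u)^-1) => c b c0.
  by field.
have h : (fun u : R => - (2^-1 * (1 + u)^-1)) u @[u --> (0 : R)] --> - (2^-1 * (1 + 0)^-1 : R).
  apply: cvgN; apply: cvgM; first exact: cvg_cst.
  apply: cvgV; first by rewrite addr0 oner_neq0.
  by apply: cvgD; [exact: cvg_cst|exact: cvg_id].
by rewrite addr0 invr1 mulr1 in h.
Qed.

(** The square roots start at [sqrt 2] so that all of them exceed 1, as the
    domination of the tilt requires. *)
Definition root_seq n : R := Num.sqrt n.+2%:R.

Lemma root_seqX n : root_seq n ^+ 2 = n.+2%:R.
Proof. by rewrite sqr_sqrtr. Qed.

Lemma root_seq_gt1 n : 1 < root_seq n.
Proof. by rewrite -[ltLHS]sqrtr1 ltr_sqrt ?ltr0n// ltr1n. Qed.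

Lemma root_seq_gt0 n : 0 < root_seq n.
Proof. by apply: lt_trans (root_seq_gt1 n). Qed.

Lemma root_seq_cvgy : root_seq n @[n --> \oo] --> +oo.
Proof.
apply/cvgryPge => A; near=> n.
have [A0|A0] := leP A 0; first by rewrite (le_trans A0)// sqrtr_ge0.
rewrite -(@ler_pXn2r _ 2)// ?nnegrE ?sqrtr_ge0 ?(ltW A0)//.
rewrite root_seqX; apply: (@le_trans _ _ n%:R); last by rewrite ler_nat; lia.
by near: n; exact: nbhs_infty_ger.
Unshelve. all: by end_near. Qed.

(** The logarithm of the tilt is [v ^ 2 * (ln (1 + u) - u) / u ^ 2] at
    [u = v / root_seq n]. *)
Lemma tilt_cvg v : tilt (root_seq n) n.+2 v @[n --> \oo] --> expR (- (v ^+ 2 / 2)).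
Proof.
have [->|v0] := eqVneq v 0.
  rewrite expr0n/= mul0r oppr0 expR0.
  rewrite (_ : (fun n => _) = cst 1); first exact: cvg_cst.
  by apply/funext => n; rewrite /tilt mul0r addr0 expr1n mul1r mulr0 oppr0 expR0.
pose phi u : R := (ln (1 + u) - u) / u ^+ 2.
have u0 : v / root_seq n @[n --> \oo] --> 0.
  have h : v / root_seq n @[n --> \oo] --> v * 0.
    apply: cvgM; first exact: cvg_cst.
    apply/gtr0_cvgV0; last exact: root_seq_cvgy.
    by apply: nearW => n; exact: root_seq_gt0.
  by rewrite mulr0 in h.
have phiv : phi (v / root_seq n) @[n --> \oo] --> - (2^-1 : R).
  apply: (@cvg_comp _ _ _ (fun n => v / root_seq n) phi _ (0 : R)^'); last exact: ln1D_second_order.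
  move=> A; rewrite /dnbhs /within /= => hA.
  have [N _ hN] := u0 _ hA; exists N => // n /hN; apply.
  by apply: (mulf_neq0 v0); rewrite invr_neq0 // lt0r_neq0 // root_seq_gt0.
have E : \forall n \near \oo, expR (v ^+ 2 * phi (v / root_seq n)) = tilt (root_seq n) n.+2 v.
  near=> n; have s0 := root_seq_gt0 n.
  have p0 : 0 < 1 + v / root_seq n.
    have : - v < root_seq n by near: n; move/cvgryPgt : root_seq_cvgy; apply.
    have -> : 1 + v / root_seq n = (root_seq n + v) / root_seq n by field; rewrite lt0r_neq0.
    by move=> h; apply: divr_gt0 => //; lra.
  rewrite /tilt -[in RHS](lnK p0) -expRM_natl -expRD -root_seqX; congr expR.
  by rewrite /phi; field; rewrite v0 lt0r_neq0.
apply: cvg_trans (near_eq_cvg E) _.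
apply: (@cvg_comp _ _ _ (fun n => v ^+ 2 * phi (v / root_seq n)) expR); last exact: continuous_expR.
by rewrite -mulrN; apply: cvgM; [exact: cvg_cst|].
Unshelve. all: by end_near. Qed.

End gaussian_limit.

Section poisson_tail_limit.
Context {R : realType}.
Implicit Types (m n k : nat) (v u a : R).
Notation mu := lebesgue_measure.

Lemma integrable_exp_abs : mu.-integrable setT (fun v : R => (expR (1 - `|v| / 2))%:E).
Proof.
have cf : continuous (fun v : R => expR (1 - `|v| / 2)).
  move=> v; apply: (@cvg_comp _ _ _ (fun v : R => 1 - `|v| / 2) expR); last exact: continuous_expR.
  apply: cvgB; first exact: cvg_cst.
  by apply: cvgM; [exact: (@norm_continuous _ R)|exact: cvg_cst].
have mf : measurable_fun setT (fun v : R => (expR (1 - `|v| / 2))%:E).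
  by apply/measurable_EFinP; exact: continuous_measurable_fun.
apply/integrableP; split => //.
under eq_integral do rewrite gee0_abs ?lee_fin ?expR_ge0//.
rewrite ge0_symfun_integralT//; last by move=> v /=; rewrite normrN.
have -> : (\int[mu]_(x in [set x : R | (0 <= x)%R]) (expR (1 - `|x| / 2))%:E =
    \int[mu]_(x in `[(0 : R)%R, +oo[) (expR (1 - x / 2))%:E)%E.
  rewrite -set_itvcy; apply: eq_integral => v; rewrite inE/= in_itv/= andbT => v0.
  by rewrite ger0_norm.
have dF v : is_derive v 1 (fun v : R => - (2 * expR (1 - v / 2))) (expR (1 - v / 2)).
  have dA : is_derive v 1 (fun v : R => 1 - v / 2) (- 2^-1).
    have -> : (fun v : R => 1 - v / 2) = cst 1 - 2^-1 \*: id.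
      by apply/funext => x /=; rewrite mulrC.
    apply: (is_derive_eq (is_deriveB (is_derive_cst (1 : R) v 1) (is_deriveZ (2^-1 : R) (is_derive_id v 1)))).
    by rewrite sub0r /GRing.scale/= mulr1.
  have D := is_deriveN (is_deriveZ (2 : R) (@is_derive1_comp R expR (fun v => 1 - v / 2) v _ _ (is_derive_expR _) dA)).
  by apply: (is_derive_eq D); rewrite /GRing.scale/=; field.
rewrite (@ge0_continuous_FTC2y _ _ (fun v : R => - (2 * expR (1 - v / 2))) _ 0).
- by rewrite -EFinB -EFinM ltry.
- by move=> v _; rewrite expR_ge0.
- apply: continuous_subspaceT => v.
  apply: (@cvg_comp _ _ _ (fun v : R => 1 - v / 2) expR); last exact: continuous_expR.
  by apply: cvgB; [exact: cvg_cst|apply: cvgM; [exact: cvg_id|exact: cvg_cst]].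
- have h : (fun v : R => - (2 * expR (1 - v / 2))) v @[v --> +oo] --> - (2 * 0 : R).
    apply: cvgN; apply: cvgM; first exact: cvg_cst.
    rewrite (_ : (fun _ => _) = (fun y => expR (- y)) \o (fun v : R => v / 2 - 1)); last first.
      by apply/funext => v /=; rewrite opprB.
    apply: cvg_comp; last exact: cvgr_expR.
    apply/cvgryPge => A; near=> v; rewrite lerBrDr ler_pdivlMr//.
  by rewrite mulr0 oppr0 in h.
- by move=> v _; apply: ex_derive; exact: dF.
- apply: cvg_at_right_filter.
  by have /derivable1_diffP/differentiable_continuous := @ex_derive _ _ _ _ _ _ _ (dF 0).
- by move=> v _; rewrite derive1E; apply: derive_val; exact: dF.
Unshelve. all: by end_near. Qed.

(** Below [- root_seq n] the mean [s ^ 2 + s * v] is negative and the tilt is no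
    density. *)
Definition tilt_trunc n v : R :=
  if - root_seq n <= v then tilt (root_seq n) n.+2 v else 0.

Lemma measurable_tilt_trunc n : measurable_fun setT (tilt_trunc n).
Proof.
apply: measurable_fun_if => //.
- by apply: measurable_fun_ler => //; exact: measurable_cst.
- by apply: measurable_funTS; apply: continuous_measurable_fun; exact: continuous_tilt.
Qed.

Lemma cvg_integral_tilt (D : set R) : measurable D ->
  (\int[mu]_(v in D) (tilt_trunc n v)%:E)%E @[n --> \oo] -->
  (\int[mu]_(v in D) (expR (- (v ^+ 2 / 2)))%:E)%E.
Proof.
move=> mD; apply: (@dominated_cvg _ _ R mu D mD (fun n v => (tilt_trunc n v)%:E)
  (fun v => (expR (- (v ^+ 2 / 2)))%:E) (fun v : R => (expR (1 - `|v| / 2))%:E)).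
- by move=> n; apply/measurable_EFinP; apply: measurable_funTS; exact: measurable_tilt_trunc.
- move=> v _; apply: cvg_EFin; first exact: nearW.
  suff : tilt_trunc n v @[n --> \oo] --> expR (- (v ^+ 2 / 2)) by [].
  apply: (cvg_trans _ (@tilt_cvg R v)); apply: near_eq_cvg; near=> n.
  rewrite /= /tilt_trunc ifT// lerNl.
  by near: n; move/cvgryPge : (@root_seq_cvgy R); apply.
- by [].
- by apply: integrableS integrable_exp_abs.
- move=> n v _; rewrite lee_fin /tilt_trunc; case: ifPn => h; last by rewrite normr0 expR_ge0.
  rewrite ger0_norm; last exact/tilt_ge0/h/root_seq_gt0.
  by apply: tilt_le => //; [exact: root_seqX|exact: root_seq_gt1].
Unshelve. all: by end_near. Qed.

Lemma integral_gauss_normal_prob (D : set R) : measurable D ->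
  (\int[mu]_(v in D) (expR (- (v ^+ 2 / 2)))%:E)%E =
  (((normal_peak 1)^-1)%:E * normal_prob (0 : R) 1 D)%E.
Proof.
move=> mD; rewrite /normal_prob normal_pdfE ?oner_neq0//.
have p0 := @normal_peak_gt0 R 1 (oner_neq0 R).
under [in RHS]eq_integral do rewrite EFinM.
rewrite ge0_integralZl//; last 3 first.
- by apply/measurable_EFinP; apply: measurable_funTS; exact: measurable_normal_fun.
- by move=> v _; rewrite lee_fin normal_fun_ge0.
- by rewrite lee_fin ltW.
rewrite muleA -EFinM mulVf ?lt0r_neq0// mul1e; apply: eq_integral => v _.
by rewrite /normal_fun subr0 expr1n mulr2n mulNr.
Qed.

(** Up to the same factor, the distribution function at mean [s ^ 2 + s * a] is the
    integral of the tilt from [a], and its value 1 at mean 0 is the integral of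
    the tilt from [- s].  Both integrals converge to Gaussian ones by dominated
    convergence, and their quotient is free of the factor. *)
Lemma poisson_cdf_tail_cvg a :
  poisson_cdf n.+2 (n.+2%:R + root_seq n * a) @[n --> \oo] -->
  fine (normal_prob (0 : R) 1 `[a, +oo[).
Proof.
pose I (D : set R) n := fine (\int[mu]_(v in D) (tilt_trunc n v)%:E)%E.
have p0 := @normal_peak_gt0 R 1 (oner_neq0 R).
have Icvg (D : set R) : measurable D -> I D n @[n --> \oo] --> (normal_peak 1)^-1 * fine (normal_prob (0 : R) 1 D).
  move=> mD; apply: fine_cvg; rewrite EFinM fineK ?fin_num_measure//.
  by rewrite -integral_gauss_normal_prob//; exact: cvg_integral_tilt.
have NT : normal_prob (0 : R) 1 [set: R] = 1%E by exact: (@probability_setT _ _ _ (normal_prob (0 : R) 1)).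
have h : I `[a, +oo[%classic n / I setT n @[n --> \oo] -->
   ((normal_peak 1)^-1 * fine (normal_prob (0 : R) 1 `[a, +oo[)) / ((normal_peak 1)^-1 * fine (normal_prob (0 : R) 1 setT)).
  apply: cvgM; first exact: Icvg.
  apply: cvgV; last exact: Icvg.
  by rewrite NT mulr1 invr_neq0// lt0r_neq0.
have E x : (normal_peak (1 : R))^-1 * x / ((normal_peak 1)^-1 * fine (normal_prob (0 : R) 1 setT)) = x.
  by rewrite NT mulr1 mulrAC mulfV ?mul1r// invr_neq0// lt0r_neq0.
rewrite E in h.
apply: (cvg_trans _ h); apply: near_eq_cvg; near=> n.
have s0 := @root_seq_gt0 R n.
have c0 := tilt_const_gt0 n.+2 s0.
have sa : - root_seq n <= a.
  by rewrite lerNl; near: n; move/cvgryPge : (@root_seq_cvgy R); apply.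
have -> : I `[a, +oo[%classic n = poisson_cdf n.+2 (n.+2%:R + root_seq n * a) / tilt_const (root_seq n) n.+2.
  rewrite /I -[RHS]/(fine (_ / _)%:E) -root_seqX -integral_tilt//.
  congr fine; apply: eq_integral => v; rewrite inE/= in_itv/= andbT => av.
  by rewrite /tilt_trunc ifT// (le_trans sa).
have -> : I setT n = (tilt_const (root_seq n) n.+2)^-1.
  rewrite /I (_ : (\int[mu]_v _)%E = (\int[mu]_(v in `[(- root_seq n)%R, +oo[) (tilt (root_seq n) n.+2 v)%:E)%E).
    rewrite integral_tilt//= mulrN -expr2 subrr.
    rewrite /poisson_cdf big_ord_recl/= expr0 fact0 divr1 mul1r oppr0 expR0 big1 ?addr0 ?mul1r//.
    by move=> i _; rewrite expr0n/= !mul0r.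
  rewrite [RHS]integral_mkcond; apply: eq_integral => v _.
  rewrite /tilt_trunc patchE; case: ifPn => hs.
    by rewrite mem_set//= in_itv/= hs.
  by rewrite memNset//= in_itv/= andbT; exact/negP.
by rewrite invrK divfK// lt0r_neq0.
Unshelve. all: by end_near. Qed.

End poisson_tail_limit.

(** * Quantiles of the Poisson and normal laws *)

Section normal_cdf.
Context {R : realType}.
Notation mu := lebesgue_measure.
Implicit Types (x y : R).

Definition Phi x : R := fine (normal_prob (0 : R) 1 `]-oo, x]).

Lemma normal_prob_sym x :
  normal_prob (0 : R) 1 `[- x, +oo[ = normal_prob (0 : R) 1 `]-oo, x].
Proof.
rewrite /normal_prob -[in RHS](opprK x) ge0_integration_by_substitutionNy.
- apply: eq_integral => v _ /=; rewrite !normal_pdfE ?oner_neq0//.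
  by rewrite /normal_fun !subr0 sqrrN.
- apply: continuous_subspaceT; apply: continuous_normal_pdf; exact: oner_neq0.
- by move=> v _; exact: normal_pdf_ge0.
Qed.

Lemma Phi_lt x y : x < y -> Phi x < Phi y.
Proof.
move=> xy; rewrite /Phi -lte_fin !fineK ?fin_num_measure//.
have -> : `]-oo, y]%classic = `]-oo, x] `|` `]x, y].
  by rewrite -itv_bndbnd_setU// bnd_simp// ltW.
rewrite measureU//; last first.
  by apply/seteqP; split => // z /=; rewrite !in_itv/= => -[zx /andP[xz _]]; lra.
rewrite lteDl ?fin_num_measure//.
pose c := Num.max `|x| `|y|.
have c0 : 0 < normal_pdf (0 : R) 1 c.
  by rewrite normal_pdfE ?oner_neq0// mulr_gt0 ?expR_gt0// normal_peak_gt0// oner_neq0.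
apply: (@lt_le_trans _ _ (\int[mu]_(v in `]x, y]) (normal_pdf (0 : R) 1 c)%:E)%E).
  rewrite integral_cst//= lebesgue_measure_itv/= lte_fin xy -EFinD -EFinM lte_fin.
  by rewrite mulr_gt0// subr_gt0.
apply: ge0_le_integral => //.
- by move=> v _; rewrite lee_fin ltW.
- by apply/measurable_EFinP; apply: measurable_funTS; exact: measurable_normal_pdf.
move=> v /=; rewrite in_itv/= => /andP[xv vy]; rewrite lee_fin !normal_pdfE ?oner_neq0//.
rewrite ler_wpM2l ?normal_peak_ge0// ler_expR !subr0 !mulNr lerN2 ler_wpM2r//.
have vc : `|v| <= c.
  rewrite /c le_max; have [v0|v0] := leP 0 v.
    by apply/orP; right; rewrite (ger0_norm v0) ger0_norm // (le_trans v0 vy).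
  by apply/orP; left; rewrite (ltr0_norm v0) ltr0_norm ?(lt_trans xv) // lerN2 ltW.
by rewrite -real_normK ?num_real// lerXn2r// ?nnegrE// (le_trans _ vc).
Qed.

End normal_cdf.

Section poisson_cdf_normal.
Context {R : realType}.
Implicit Types (x y : R).

Lemma poisson_cdf_nincr m y1 y2 : 0 <= y1 -> y1 <= y2 ->
  @poisson_cdf R m y2 <= poisson_cdf m y1.
Proof.
have D y := is_derive_poisson_cdf m (y : R).
apply: ler0_derive1_nincry.
- by move=> x _; apply: ex_derive; exact: D.
- move=> x; rewrite in_itv/= andbT => x0; rewrite derive1E derive_val oppr_le0.
  by rewrite mulr_ge0 ?expR_ge0// divr_ge0// exprn_ge0// ltW.
- apply: continuous_subspaceT => x.
  by have /derivable1_diffP/differentiable_continuous := @ex_derive _ _ _ _ _ _ _ (D x).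
Qed.

Lemma poisson_cdf_mono m n y : 0 <= y -> (m <= n)%N ->
  @poisson_cdf R m y <= poisson_cdf n y.
Proof.
move=> y0; apply: (@homo_leq _ (fun k => poisson_cdf k y) (fun a b => a <= b)) => //.
  by move=> b a c; exact: le_trans.
move=> k.
rewrite /poisson_cdf [leRHS]big_ord_recr/= lerDl.
by rewrite mulr_ge0 ?expR_ge0// divr_ge0// exprn_ge0.
Qed.

Variable lam : nat -> R.
Hypothesis lam_ge0 : forall n, 0 <= lam n.
Hypothesis lam_cvgy : lam n @[n --> \oo] --> +oo.

Let r n := Num.sqrt (lam n).
Let lev x n := lam n + x * r n.
Let mlev x n := Num.truncn (lev x n).

Let r2 n : r n ^+ 2 = lam n. Proof. by rewrite sqr_sqrtr. Qed.
Let r0 n : 0 <= r n. Proof. exact: sqrtr_ge0. Qed.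

Lemma sqrt_cvgy : r n @[n --> \oo] --> +oo.
Proof.
apply/cvgryPge => A; near=> n.
have [A0|A0] := leP A 0; first by rewrite (le_trans A0)// sqrtr_ge0.
rewrite -(@ler_pXn2r _ 2)// ?nnegrE ?sqrtr_ge0 ?(ltW A0)//.
by rewrite r2; near: n; move/cvgryPge : lam_cvgy; apply.
Unshelve. all: by end_near. Qed.

Let near_r A : \forall n \near \oo, A <= r n.
Proof. by move/cvgryPge : sqrt_cvgy; apply. Qed.

Let lev_ge x A : \forall n \near \oo, A <= lev x n.
Proof.
near=> n; have rn : `|x| + `|A| + 1 <= r n by near: n; exact: near_r.
rewrite /lev -r2; have := ler_norm A; have := lerNnormlW (lexx `|x|).
have := normr_ge0 x; have := normr_ge0 A.
move: `|x| `|A| rn => X B rn B0 X0 xX AB.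
apply: (le_trans AB); nra.
Unshelve. all: by end_near. Qed.

Let mlev_cvg x : mlev x n @[n --> \oo] --> \oo.
Proof.
apply/cvgnyPge => A; near=> n.
have : A%:R <= lev x n by near: n; exact: lev_ge.
by move=> h; rewrite /mlev truncn_ge_nat// (le_trans _ h).
Unshelve. all: by end_near. Qed.

Let p x n : R := Num.sqrt (mlev x n)%:R.

Let p2 x n : p x n ^+ 2 = (mlev x n)%:R. Proof. by rewrite sqr_sqrtr. Qed.
Let p0 x n : 0 <= p x n. Proof. exact: sqrtr_ge0. Qed.

Let mlev_itv x : \forall n \near \oo,
  p x n ^+ 2 <= r n ^+ 2 + x * r n /\ r n ^+ 2 + x * r n < p x n ^+ 2 + 1.
Proof.
near=> n; have h : 0 <= lev x n by near: n; exact: lev_ge.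
have /andP[h1 h2] := truncn_itv h.
by rewrite p2 r2 natr1.
Unshelve. all: by end_near. Qed.

(* The square roots of [lam n] and of the level [lam n + x * sqrt (lam n)] remain at
   bounded distance, which absorbs the change from the mean [lam n] to the level
   as the centre of the normalization. *)
Let near_sqrt x : \forall n \near \oo, `|p x n - r n| <= `|x| + 2.
Proof.
near=> n; have rn : `|x| + 3 <= r n by near: n; exact: near_r.
have [h1 h2] : p x n ^+ 2 <= r n ^+ 2 + x * r n /\ r n ^+ 2 + x * r n < p x n ^+ 2 + 1.
  by near: n; exact: mlev_itv.
have x1 := ler_norm x; have x2 := lerNnormlW (lexx `|x|); have x0 := normr_ge0 x.
have := p0 x n; move: (p x n) h1 h2 => q h1 h2 q0.
move: `|x| (r n) rn h1 h2 x1 x2 x0 => X s rn h1 h2 x1 x2 X0.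
rewrite ler_norml; apply/andP; split.
  have : s - X - 2 <= q; last by lra.
  rewrite -(@ler_pXn2r _ 2)// ?nnegrE//; last by lra.
  by nra.
have : q <= s + X; last by lra.
by rewrite -(@ler_pXn2r _ 2)// ?nnegrE//; [nra|lra].
Unshelve. all: by end_near. Qed.

Let tail_at x (a : R) : poisson_cdf (mlev x n) ((mlev x n)%:R + p x n * a) @[n --> \oo]
  --> fine (normal_prob (0 : R) 1 `[a, +oo[).
Proof.
(* The tail limit is indexed from [m = 2]. *)
have h : (mlev x n - 2)%N @[n --> \oo] --> \oo.
  apply/cvgnyPge => A; near=> n.
  have : (A + 2 <= mlev x n)%N by near: n; move/cvgnyPge : (mlev_cvg x); apply.
  by lia.
have := @cvg_comp _ _ _ (fun n => (mlev x n - 2)%N)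
  (fun n => poisson_cdf n.+2 (n.+2%:R + root_seq n * a)) _ _ _ h (@poisson_cdf_tail_cvg R a).
apply: cvg_trans; apply: near_eq_cvg; near=> n.
have m2 : (2 <= mlev x n)%N by near: n; move/cvgnyPge : (mlev_cvg x); apply.
have E : (mlev x n - 2).+2 = mlev x n by lia.
by rewrite /= /root_seq E.
Unshelve. all: by end_near. Qed.

(** With [m] the integer part of [lam + x * sqrt lam], the mean [lam] is eventually
    below [m - x' * sqrt m] because [x' < x], and the distribution function
    decreases with the mean. *)
Lemma near_poisson_cdf_gt x x' v : x' < x -> v < Phi x' ->
  \forall n \near \oo, v < poisson_cdf (Num.truncn (lam n + x * Num.sqrt (lam n))) (lam n).
Proof.
move=> xx; rewrite /Phi -normal_prob_sym => /(cvgr_gt _ (tail_at x (a := - x'))) hT.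
near=> n; have vT : v < poisson_cdf (mlev x n) ((mlev x n)%:R + p x n * - x') by near: n.
apply: (lt_le_trans vT); apply: (@poisson_cdf_nincr (mlev x n)) => //.
have rn : (1 + `|x'| * (`|x| + 2)) / (x - x') <= r n by near: n; exact: near_r.
have [_ h2] : p x n ^+ 2 <= r n ^+ 2 + x * r n /\ r n ^+ 2 + x * r n < p x n ^+ 2 + 1.
  by near: n; exact: mlev_itv.
have hpr : `|p x n - r n| <= `|x| + 2 by near: n; exact: near_sqrt.
have hx : x' * (p x n - r n) <= `|x'| * (`|x| + 2).
  by rewrite (le_trans (ler_norm _))// normrM ler_wpM2l.
rewrite ler_pdivrMr ?subr_gt0// in rn.
rewrite -p2 -r2; move: (p x n) (r n) (`|x'| * _) h2 hx rn => q s c h2 hx rn.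
by nra.
Unshelve. all: by end_near. Qed.

Lemma near_poisson_cdf_lt x x' v : x < x' -> Phi x' < v ->
  \forall n \near \oo, poisson_cdf (Num.truncn (lam n + x * Num.sqrt (lam n))) (lam n) < v.
Proof.
move=> xx; rewrite /Phi -normal_prob_sym => /(cvgr_lt _ (tail_at x (a := - x'))) hT.
near=> n; have vT : poisson_cdf (mlev x n) ((mlev x n)%:R + p x n * - x') < v by near: n.
apply: le_lt_trans vT.
have rn : (`|x'| * (`|x| + 2)) / (x' - x) <= r n by near: n; exact: near_r.
have rn2 : `|x'| + `|x| + 2 <= r n by near: n; exact: near_r.
have [h1 _] : p x n ^+ 2 <= r n ^+ 2 + x * r n /\ r n ^+ 2 + x * r n < p x n ^+ 2 + 1.
  by near: n; exact: mlev_itv.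
have hpr : `|p x n - r n| <= `|x| + 2 by near: n; exact: near_sqrt.
have hx : - (`|x'| * (`|x| + 2)) <= x' * (p x n - r n).
  by rewrite lerNl (le_trans (ler_norm _))// normrN normrM ler_wpM2l.
rewrite ler_pdivrMr ?subr_gt0// in rn.
have qx : x' <= p x n.
  move: hpr; rewrite ler_norml => /andP[+ _]; have := ler_norm x'; lra.
apply: (@poisson_cdf_nincr (mlev x n)).
  rewrite -p2; move: (p x n) qx (p0 x n) => q qx q0; nra.
rewrite -p2 -r2; move: (p x n) (r n) (`|x'| * _) h1 hx rn => q s c h1 hx rn.
by nra.
Unshelve. all: by end_near. Qed.

End poisson_cdf_normal.

Section normal_quantile.
Context {R : realType}.
Implicit Types (x y u : R).

Let N : probability (measurableTypeR R) R := normal_prob (0 : R) 1.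

Let idTR : measurableTypeR R -> R := idfun.

#[local] HB.instance Definition _ :=
  @isMeasurableFun.Build _ _ _ _ idTR (@measurable_id _ _ setT).

Let PhiE x : (Phi x)%:E = cdf (idTR : {RV N >-> R}) x.
Proof. by rewrite /Phi fineK ?fin_num_measure. Qed.

Let cdfE : cdf (idTR : {RV N >-> R}) = EFin \o @Phi R.
Proof. by apply/funext => x /=; rewrite PhiE. Qed.

Lemma Phi_le x y : x <= y -> Phi x <= Phi y.
Proof. by rewrite le_eqVlt => /orP[/eqP ->//|/Phi_lt/ltW]. Qed.

Lemma Phi_cvgy : Phi x @[x --> +oo] --> (1 : R).
Proof.
by have := cvg_cdfy1 (idTR : {RV N >-> R}); rewrite cdfE => /fine_cvg.
Qed.

Lemma Phi_cvgNy : Phi x @[x --> -oo] --> (0 : R).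
Proof.
by have := cvg_cdfNy0 (idTR : {RV N >-> R}); rewrite cdfE => /fine_cvg.
Qed.

Lemma Phi_right_continuous : right_continuous (@Phi R).
Proof.
move=> x; have := @cdf_right_continuous _ _ _ N (idTR : {RV N >-> R}) x.
by rewrite cdfE => /fine_cvg.
Qed.

Definition normal_quantile u : R := inf [set x | u <= Phi x].

(** By right continuity of the distribution function the infimum is attained. *)
Lemma normal_quantile_le u x : 0 < u < 1 -> (normal_quantile u <= x) = (u <= Phi x).
Proof.
move=> /andP[u0 u1]; pose S := [set x | u <= Phi x].
have S0 : S !=set0.
  have [M [_ hM]] := cvgr_gt _ Phi_cvgy _ u1.
  by exists (M + 1); apply/ltW/hM; lra.
have [M [_ hM]] := cvgr_lt _ Phi_cvgNy _ u0.
have lbS : has_lbound S.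
  exists (M - 1) => y uy; rewrite leNgt; apply/negP => yM.
  by have := hM y ltac:(lra); rewrite ltNge uy.
have uq : u <= Phi (normal_quantile u).
  apply: (cvgr_to_ge (@Phi_right_continuous (normal_quantile u))).
  near=> y; have qy : normal_quantile u < y by [].
  have [z Sz zy] : exists2 z, S z & z < y.
    apply: contrapT => h; move: qy; rewrite ltNge => /negP; apply.
    apply: lb_le_inf => // z Sz; rewrite leNgt; apply/negP => zy.
    by apply: h; exists z.
  by apply: (le_trans Sz); apply: Phi_le; exact: ltW.
apply/idP/idP => [qx|ux]; first by rewrite (le_trans uq)// Phi_le.
exact: (ge_inf lbS).
Unshelve. all: by end_near. Qed.

End normal_quantile.

Section poisson_quantile.
Context {R : realType}.
Implicit Types (l x y u : R).

Lemma poisson_cdfE m l : 0 < l -> poisson_cdf m l = \sum_(k < m.+1) poisson_pmf l k.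
Proof. by move=> l0; apply: eq_bigr => k _; rewrite poisson_pmfE. Qed.

Lemma poisson_cdf_reach l u : 0 < l -> u < 1 -> exists m, u <= poisson_cdf m l.
Proof.
move=> l0 u1; apply: contrapT => /forallNP h.
have : (\sum_(m <oo) (poisson_pmf l m)%:E <= u%:E)%E.
  apply: lime_le.
    by apply: is_cvg_nneseries => m _ _; rewrite lee_fin poisson_pmf_ge0.
  apply: nearW => m; rewrite big_mkord sumEFin lee_fin.
  apply: (@le_trans _ _ (\sum_(k < m.+1) poisson_pmf l k)).
    by rewrite big_ord_recr/= lerDl poisson_pmf_ge0.
  by rewrite -poisson_cdfE//; apply: ltW; rewrite ltNge; apply/negP; exact: h.
by rewrite poisson_pmf_sum1// lee_fin leNgt u1.
Qed.

(** Chosen by the Galois connection with the distribution function, which determines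
    it. *)
Definition poisson_quantile l u : nat :=
  xget 0%N [set m | forall n, (m <= n)%N = (u <= poisson_cdf n l)].

Lemma poisson_quantile_le l u n : 0 < l -> u < 1 ->
  (poisson_quantile l u <= n)%N = (u <= poisson_cdf n l).
Proof.
move=> l0 u1; suff : [set m | forall n, (m <= n)%N = (u <= poisson_cdf n l)] (poisson_quantile l u).
  by apply.
apply: xgetPex; have [m0 hm0] := poisson_cdf_reach l0 u1.
have ex : exists m, u <= poisson_cdf m l by exists m0.
exists (ex_minn ex) => k; case: ex_minnP => m hm minm.
apply/idP/idP => [mk|]; last exact: minm.
by apply: (le_trans hm); apply: poisson_cdf_mono => //; exact: ltW.
Qed.

(** By the Galois connections, an error larger than [e] on the quantile would
    contradict the limit of the distribution functions at [q - e] or [q + e],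
    where the strict growth of [Phi] separates the limit from [u]. *)
Lemma poisson_quantile_cvg (lam : nat -> R) u :
  (forall n, 0 < lam n) -> lam n @[n --> \oo] --> +oo -> 0 < u < 1 ->
  ((poisson_quantile (lam n) u)%:R - lam n) / Num.sqrt (lam n) @[n --> \oo] -->
  normal_quantile u.
Proof.
move=> lam0 lamy /[dup] u01 /andP[u0 u1]; set q := normal_quantile u.
have lam_ge0 n : 0 <= lam n by exact: ltW.
have s0 n : 0 < Num.sqrt (lam n) by rewrite sqrtr_gt0.
apply/cvgrPdist_le => e e0; near=> n.
have levq x : `|x| <= Num.sqrt (lam n) -> 0 <= lam n + x * Num.sqrt (lam n).
  move=> hx; rewrite -[X in X + _](@sqr_sqrtr _ (lam n))//.
  have := lerNnormlW (lexx `|x|); have := s0 n; move: (Num.sqrt _) hx => s; nra.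
rewrite distrC ler_norml; apply/andP; split.
  rewrite lerBrDr ler_pdivlMr// lerBrDr addrC.
  rewrite leNgt; apply/negP => h.
  have : (poisson_quantile (lam n) u <= Num.truncn (lam n + (q - e) * Num.sqrt (lam n)))%N.
    rewrite truncn_ge_nat ?(addrC q)//; first exact: ltW.
    rewrite addrC; apply: levq; near: n.
    by move/cvgryPge : (sqrt_cvgy lam_ge0 lamy); apply.
  rewrite poisson_quantile_le//; apply/negP; rewrite -ltNge; near: n.
  apply: (@near_poisson_cdf_lt _ _ lam_ge0 lamy (q - e) (q - e / 2)); first by lra.
  by rewrite ltNge -normal_quantile_le// -ltNge -/q; lra.
rewrite lerBlDr ler_pdivrMr// lerBlDr.
have : (poisson_quantile (lam n) u <= Num.truncn (lam n + (q + e) * Num.sqrt (lam n)))%N.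
  rewrite poisson_quantile_le//; apply: ltW; near: n.
  apply: (@near_poisson_cdf_gt _ _ lam_ge0 lamy (q + e) (q + e / 2)); first by lra.
  apply: (@le_lt_trans _ _ (Phi q)); first by rewrite -normal_quantile_le.
  by apply: Phi_lt; lra.
rewrite truncn_ge_nat; first by move=> h; rewrite [e + q]addrC [leRHS]addrC.
apply: levq; near: n.
by move/cvgryPge : (sqrt_cvgy lam_ge0 lamy); apply.
Unshelve. all: by end_near. Qed.

End poisson_quantile.

Section normal_scaling.
Context {R : realType}.
Notation mu := lebesgue_measure.
Implicit Types (x y s : R).

Lemma normal_prob_scale s y : 0 < s ->
  normal_prob (0 : R) s `]-oo, (s * y)] = normal_prob (0 : R) 1 `]-oo, y].
Proof.
move=> s0; rewrite /normal_prob.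
have D : derive1 (fun x : R => s * x) = cst s.
  apply/funext => x; rewrite derive1E.
  have := @derive_val _ _ _ _ _ _ _ (is_deriveZ s (is_derive_id x (1 : R))).
  by rewrite /GRing.scale/= mulr1.
rewrite (@increasing_ge0_integration_by_substitutionNy _ (fun x => s * x) _ y).
- apply: eq_integral => x _; rewrite D mulrfctE /= !normal_pdfE ?oner_neq0 ?lt0r_neq0//.
  congr EFin; rewrite /normal_peak /normal_fun !subr0 !expr1n mul1r.
  have -> : Num.sqrt (s ^+ 2 * pi *+ 2) = s * Num.sqrt (pi *+ 2).
    by rewrite -mulrnAr sqrtrM ?sqr_ge0// sqrtr_sqr gtr0_norm.
  have -> : - (s * x) ^+ 2 / (s ^+ 2 *+ 2) = - x ^+ 2 / 2.
    by field; rewrite lt0r_neq0.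
  have : Num.sqrt (pi *+ 2) != 0 :> R by rewrite lt0r_neq0// sqrtr_gt0 mulrn_wgt0// pi_gt0.
  move: (expR _) (Num.sqrt (pi *+ 2)) => e c c0.
  by field; rewrite c0 lt0r_neq0.
- by move=> a b _ _ ab; rewrite ltr_pM2l.
- by rewrite D => x _; exact: cvg_cst.
- by rewrite D; exact: is_cvg_cst.
- by rewrite D; exact: cvg_cst.
- split.
    by move=> x _; apply: ex_derive; exact: (is_deriveZ s (is_derive_id x (1 : R))).
  apply: cvg_at_left_filter; apply: cvgM; [exact: cvg_cst|exact: cvg_id].
- apply/gt0_cvgMrNy => //; exact: cvg_id.
- by apply: continuous_subspaceT; apply: continuous_normal_pdf; rewrite lt0r_neq0.
- by move=> x _; exact: normal_pdf_ge0.
Qed.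

End normal_scaling.

(** * A sequence of independent uniform variables *)

Section measure_eq_rays.
Context {R : realType}.

(** The right open rays form a system closed under finite intersections that
    generates the Borel sets. *)
Lemma measure_eq_rays (P Q : {measure set (measurableTypeR R) -> \bar R}) :
  (P setT < +oo)%E -> P setT = Q setT ->
  (forall x, P (`]-oo, x]%classic : set R) = Q (`]-oo, x]%classic : set R)) ->
  forall A, measurable A -> P A = Q A.
Proof.
move=> Pfin PQT PQ A mA.
have fin (M : {measure set (measurableTypeR R) -> \bar R}) S : M setT = P setT ->
    measurable S -> M S \is a fin_num.
  move=> MT mS; rewrite ge0_fin_numE//; apply: le_lt_trans Pfin.
  by rewrite -MT; apply: le_measure; rewrite ?inE.
have compl S : measurable S -> P S = Q S -> P (~` S) = Q (~` S).
  move=> mS PS; have mC := measurableC mS.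
  have : P S + P (~` S) = Q S + Q (~` S).
    by rewrite -!measureU// ?setUCr// setICr.
  rewrite PS -(fineK (fin Q S (esym PQT) mS)) -(fineK (fin P _ erefl mC)).
  by rewrite -(fineK (fin Q _ (esym PQT) mC)) -!EFinD => -[/addrI ->].
apply: (@dynkin_induction _ (measurableTypeR R) (@RGenOInfty.G R) (fun S => P S = Q S)).
- exact: RGenOInfty.measurableE.
- move=> _ _ [x ->] [y ->]; exists (Num.max x y).
  by apply/seteqP; split => z /=; rewrite !in_itv/= !andbT gt_max => /andP.
- by [].
- by move=> _ [x ->]; rewrite -setCitvl; apply: compl.
- by move=> S mS PS; exact: compl.
- move=> F mF tF PF.
  by rewrite !measure_bigcup//; apply: eq_eseriesr => k _; exact: PF.
- have mE : @measurable _ (measurableTypeR R) = <<s @RGenOInfty.G R >> := RGenOInfty.measurableE R.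
  by rewrite -mE.
Qed.

(** On [D], of mass [c], the variable [f] has law [Q]: the event [D] is independent of
    [f] when [m] is a probability, so independence extends from rays to Borel
    sets. *)
Lemma preimage_eq_rays d (T : measurableType d) (m : {measure set T -> \bar R})
    (f : T -> measurableTypeR R) (D : set T) (Q : probability (measurableTypeR R) R) (c : R) :
  measurable_fun setT f -> measurable D -> 0 <= c -> m D = c%:E ->
  (forall x, m (D `&` f @^-1` `]-oo, x]%classic) = (c%:E * Q (`]-oo, x]%classic : set R))%E) ->
  forall S, measurable S -> m (D `&` f @^-1` S) = (c%:E * Q S)%E.
Proof.
move=> mf mD c0 mc rays S mS.
have := @measure_eq_rays (pushforward (mrestr m mD) f) (mscale (NngNum c0) Q).
move=> /(_ mf).
have T1 : m (f @^-1` setT `&` D) = c%:E by rewrite preimage_setT setTI.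
move=> h; rewrite setIC; apply: h mS.
- by have : (m (f @^-1` setT `&` D) < +oo)%E by rewrite T1 ltry.
- have : m (f @^-1` setT `&` D) = (c%:E * Q setT)%E by rewrite T1 probability_setT mule1.
  exact.
- by move=> x; have := rays x; rewrite setIC.
Qed.

End measure_eq_rays.

Section uniform.
Context {R : realType}.
Implicit Types (x y u : R).

Let I01 : set (measurableTypeR R) := `[0, 1[%classic.

Let mI01 : measurable I01. Proof. exact: measurable_itv. Qed.

(** The uniform law on [[0, 1[], placed on the whole line so that variables with this
    law can be composed. *)
Definition unif01 : set (measurableTypeR R) -> \bar R := mrestr lebesgue_measure mI01.

HB.instance Definition _ := Measure.on unif01.

Lemma lebesgue_ray_itv x p q : p < q ->
  lebesgue_measure ([set u : R | u <= x] `&` `[p, q[) =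
  (Num.max 0 (Num.min x q - p))%:E.
Proof.
move=> pq; have [xp|px] := ltP x p.
  rewrite (_ : _ `&` _ = set0).
    by rewrite measure0; congr EFin; rewrite min_l ?max_l//; lra.
  by apply/seteqP; split => // u [/= ux]; rewrite in_itv/=; lra.
have [xq|qx] := ltP x q.
  rewrite (_ : _ `&` _ = `[p, x]%classic).
    rewrite lebesgue_measure_itv/= lte_fin; case: ltP => h.
      by rewrite max_r//; lra.
    by rewrite max_l//; lra.
  by apply/seteqP; split => u /=; rewrite !in_itv/=; lra.
rewrite (_ : _ `&` _ = `[p, q[%classic).
  by rewrite lebesgue_measure_itv/= lte_fin pq max_r//; lra.
by apply/seteqP; split => u /=; rewrite !in_itv/=; lra.
Qed.

Definition clamp x : R := Num.max 0 (Num.min x 1).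

Lemma clampE x : clamp x = if x <= 0 then 0 else if x <= 1 then x else 1.
Proof.
rewrite /clamp; have [x0|x0] := leP x 0.
  have x1 : x <= 1 by lra.
  by rewrite (min_l x1) max_l.
have [x1|x1] := leP x 1; first by rewrite max_r// ltW.
by rewrite max_r.
Qed.

Lemma clamp_half_l x : Num.max 0 (Num.min (x / 2) 2^-1 - 0) = 2^-1 * clamp x.
Proof.
have -> : Num.min (x / 2) 2^-1 - 0 = 2^-1 * Num.min x 1.
  by rewrite subr0 minr_pMr ?invr_ge0// mulr1 mulrC.
by rewrite /clamp maxr_pMr ?invr_ge0// mulr0.
Qed.

Lemma clamp_half_r x : Num.max 0 (Num.min ((x + 1) / 2) 1 - 2^-1) = 2^-1 * clamp x.
Proof.
have -> : Num.min ((x + 1) / 2) 1 - 2^-1 = 2^-1 * Num.min x 1.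
  rewrite minr_pMr ?invr_ge0// mulr1 addr_minl; congr Num.min; lra.
by rewrite /clamp maxr_pMr ?invr_ge0// mulr0.
Qed.

Lemma unif01_ray x : unif01 `]-oo, x] = (clamp x)%:E.
Proof.
by rewrite /unif01/= /mrestr/= set_itvNyc lebesgue_ray_itv// subr0.
Qed.

Lemma unif01_setT : unif01 setT = 1%E.
Proof.
by rewrite /unif01/= /mrestr/= setTI lebesgue_measure_itv/= lte_fin ltr01 oppr0 addr0.
Qed.

HB.instance Definition _ := Measure_isProbability.Build _ _ _ unif01 unif01_setT.

Definition digit u : bool := 2^-1 <= u.

Definition shift2 u : R := 2 * u - (digit u)%:R.

Let digit_set (i : bool) : set (measurableTypeR R) := [set u | digit u = i].

Lemma measurable_digit_set i : measurable (digit_set i).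
Proof.
case: i.
  rewrite (_ : digit_set true = `[(2^-1 : R), +oo[%classic) //.
  by apply/seteqP; split => u /=; rewrite /digit_set /digit /= in_itv/= andbT.
rewrite (_ : digit_set false = `]-oo, (2^-1 : R)[%classic) //.
by apply/seteqP; split => u /=; rewrite /digit_set /digit /= in_itv/= ltNge; case: (2^-1 <= u).
Qed.

Lemma measurable_shift2 : measurable_fun setT (shift2 : measurableTypeR R -> measurableTypeR R).
Proof.
apply: measurable_funB; first exact: measurable_funM.
rewrite (_ : (fun _ => _) = \1_(digit_set true)).
  by apply: measurable_indic; exact: measurable_digit_set.
apply/funext => u; rewrite indicE; congr (nat_of_bool _)%:R.
by apply/idP/idP => [h|/set_mem]; [apply/mem_set|].
Qed.

HB.instance Definition _ := @isMeasurableFun.Build _ _ (measurableTypeR R) (measurableTypeR R) shift2 measurable_shift2.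

(** The first binary digit is fair and independent of the number formed by the
    others, which is again uniform. *)
Lemma unif01_shift2 i (S : set (measurableTypeR R)) : measurable S ->
  unif01 (digit_set i `&` shift2 @^-1` S) = (2^-1%:E * unif01 S)%E.
Proof.
move=> mS; have mD := measurable_digit_set i.
have mf : measurable_fun setT (shift2 : measurableTypeR R -> measurableTypeR R).
  exact: measurable_shift2.
have rays x : unif01 (digit_set i `&` shift2 @^-1` `]-oo, x]%classic) =
    (2^-1%:E * unif01 (`]-oo, x]%classic : set R))%E.
  rewrite unif01_ray -EFinM setIC.
  rewrite /unif01/= /mrestr/=; case: i mD => mD.
    rewrite (_ : _ `&` _ = [set u | u <= (x + 1) / 2] `&` `[(2^-1 : R), 1[).
      rewrite lebesgue_ray_itv; last by lra.
      by congr EFin; rewrite -clamp_half_r.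
    apply/seteqP; split => u /=; rewrite /I01/= !in_itv/= /digit_set/= /shift2 /digit.
      move=> [[ux h] /andP[u0 u1]]; rewrite h mulr1n in ux.
      by rewrite h u1; split => //; lra.
    move=> [ux /andP[u1 u2]]; rewrite u1 mulr1n; split; first by split => //; lra.
    by apply/andP; split => //; lra.
  rewrite (_ : _ `&` _ = [set u | u <= x / 2] `&` `[0, (2^-1 : R)[).
    rewrite lebesgue_ray_itv; last by lra.
    by congr EFin; rewrite -clamp_half_l.
  apply/seteqP; split => u /=; rewrite /I01/= !in_itv/= /digit_set/= /shift2 /digit.
    move=> [[ux h] /andP[u0 u1]]; rewrite h mulr0n in ux.
    by rewrite u0 ltNge h; split => //; lra.
  move=> [ux /andP[u1 u2]]; have h : (2^-1 <= u) = false by rewrite leNgt u2.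
  rewrite h mulr0n; split; first by split => //; lra.
  by apply/andP; split => //; lra.
apply: preimage_eq_rays => //.
change (lebesgue_measure (digit_set i `&` I01) = (2^-1)%:E).
case: i mD rays => _ _.
  rewrite (_ : _ `&` _ = `[(2^-1 : R), 1[%classic).
    by rewrite lebesgue_measure_itv/= lte_fin ifT -?EFinB; [congr EFin; lra|lra].
  by apply/seteqP; split => u /=; rewrite /I01/= !in_itv/= /digit_set/= /digit;
    [move=> [-> /andP[]]|move=> /andP[h ->]; rewrite h; split => //; rewrite andbT; lra].
rewrite (_ : _ `&` _ = `[0, (2^-1 : R)[%classic).
  by rewrite lebesgue_measure_itv/= lte_fin ifT -?EFinB; [congr EFin; lra|lra].
apply/seteqP; split => u /=; rewrite /I01/= !in_itv/= /digit_set/= /digit.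
  by move=> [h /andP[-> _]]; rewrite ltNge h.
move=> /andP[-> h]; split; first by rewrite leNgt h.
by lra.
Qed.

End uniform.

Section digits.
Context {R : realType}.
Implicit Types (x y u : R) (o : bool) (n : nat).
Local Notation M := (measurableTypeR R).
Local Notation unif01 := (@unif01 R).

Lemma measurable_digit : measurable_fun setT (fun u : M => (digit u)%:R : R).
Proof.
rewrite (_ : (fun _ => _) = \1_([set u : M | digit u = true])).
  by apply: measurable_indic; exact: measurable_digit_set.
apply/funext => u; rewrite indicE; congr (nat_of_bool _)%:R.
by apply/idP/idP => [h|/set_mem]; [apply/mem_set|].
Qed.

(** The number whose first [n] binary digits are every other digit of [u], starting
    with the second if [o] holds and with the first otherwise. *)
Fixpoint digits o n u : R :=
  if n is n.+1 then
    ((digit (if o then shift2 u else u))%:R + digits o n (shift2 (shift2 u))) / 2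
  else 0.

Lemma measurable_digits o n : measurable_fun setT (digits o n : M -> M).
Proof.
have ms := @measurable_shift2 R.
elim: n => [|n IH] /=; first exact: measurable_cst.
apply: measurable_funM => //; apply: measurable_funD.
  case: o {IH}; last exact: measurable_digit.
  exact: (measurableT_comp measurable_digit ms).
exact: (measurableT_comp IH (measurableT_comp ms ms)).
Qed.

Lemma digits_le1 o n u : digits o n u <= 1.
Proof.
elim: n u => [|n IH] u //=.
have := IH (shift2 (shift2 u)); case: (digit _); rewrite ?mulr1n ?mulr0n; lra.
Qed.

Lemma digits_ndS o n u : digits o n u <= digits o n.+1 u.
Proof.
elim: n u => [|n IH] u /=; first by rewrite addr0 divr_ge0.
by rewrite ler_pM2r ?invr_gt0// lerD2l; exact: IH.
Qed.

(** The distribution function of the uniform law on the multiples of [2 ^ - n] in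
    [[0, 1[]. *)
Fixpoint digits_cdf n x : R :=
  if n is n.+1 then (digits_cdf n (2 * x) + digits_cdf n (2 * x - 1)) / 2
  else (0 <= x)%R%:R.

Lemma digits_cdf_out n x : (x < 0 -> digits_cdf n x = 0) /\ (1 <= x -> digits_cdf n x = 1).
Proof.
elim: n x => [|n IH] x /=.
  by split => h; [rewrite leNgt h|rewrite (le_trans _ h)].
split => h.
  rewrite (IH (2 * x)).1; last by lra.
  rewrite (IH (2 * x - 1)).1; last by lra.
  by rewrite addr0 mul0r.
rewrite (IH (2 * x)).2; last by lra.
rewrite (IH (2 * x - 1)).2; last by lra.
by rewrite -mulr2n divff.
Qed.

(** Outside of [[0, 1[] the two sides agree.  Inside, one of the two terms of the
    recursion is constant, and halving the other halves the error. *)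
Lemma digits_cdf_err n x : `|digits_cdf n x - clamp x| <= 2^-1 ^+ n.
Proof.
elim: n x => [|n IH] x.
  rewrite expr0 clampE /=; have [h0|h0] := leP x 0; have [h1|h1] := leP 0 x; rewrite ?subr0 ?mulr1n ?normr1 ?normr0//; try lra.
  case: ifPn => [x1|_]; last by rewrite subrr normr0.
  by rewrite ger0_norm; lra.
have [x0|x0] := ltP x 0.
  by rewrite (digits_cdf_out n.+1 x).1// clampE (ltW x0) subr0 normr0 exprn_ge0.
have [x1|x1] := leP 1 x.
  rewrite (digits_cdf_out n.+1 x).2// clampE ifF; last by apply/negbTE; rewrite -ltNge; lra.
  have [h|h] := leP x 1; last by rewrite subrr normr0 exprn_ge0.
  have -> : x = 1 by lra.
  by rewrite subrr normr0 exprn_ge0.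
have cx : clamp x = x.
  rewrite clampE (ltW x1); case: ifPn => // h.
  by lra.
rewrite cx /= exprS.
have [h|h] := ltP x 2^-1.
  rewrite (digits_cdf_out n (2 * x - 1)).1; last by lra.
  have := IH (2 * x); rewrite clampE; have -> : 2 * x <= 1 by lra.
  have -> : (if 2 * x <= 0 then 0 else 2 * x) = 2 * x by case: ifPn => //; lra.
  rewrite !ler_norml => /andP[h1 h2]; apply/andP; split; lra.
rewrite (digits_cdf_out n (2 * x)).2; last by lra.
have := IH (2 * x - 1); rewrite clampE; have -> : 2 * x - 1 <= 1 by lra.
have -> : (if 2 * x - 1 <= 0 then 0 else 2 * x - 1) = 2 * x - 1 by case: ifPn => //; lra.
rewrite !ler_norml => /andP[h1 h2]; apply/andP; split; lra.
Qed.

Lemma digits_cdf_cvg x : digits_cdf n x @[n --> \oo] --> clamp x.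
Proof.
apply/cvgrPdist_le => e e0.
have : (2^-1 : R) ^+ n @[n --> \oo] --> (0 : R).
  by apply: cvg_expr; rewrite ger0_norm ?invr_ge0//; lra.
move/cvgr0Pnorm_le => /(_ _ e0); apply: filterS => n.
rewrite ger0_norm ?exprn_ge0 ?invr_ge0// => h.
by rewrite distrC; exact: le_trans (digits_cdf_err n x) h.
Qed.

Lemma unif01_split (A : set M) : measurable A ->
  (unif01 A = unif01 ([set u | digit u = false] `&` A) +
              unif01 ([set u | digit u = true] `&` A))%E.
Proof.
move=> mA; have mD := @measurable_digit_set R.
rewrite -measureU; [|exact: measurableI|exact: measurableI|].
  rewrite -setIUl (_ : _ `|` _ = setT) ?setTI//.
  by apply/seteqP; split => // u _ /=; case: (digit u); [right|left].
by apply/seteqP; split => // u [[/= -> _] []].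
Qed.

Lemma measurable_digits_le n x y :
  measurable [set u : M | digits false n u <= x /\ digits true n u <= y].
Proof.
rewrite (_ : [set _ | _] = ([set: M] `&` digits false n @^-1` `]-oo, x]) `&`
   ([set: M] `&` digits true n @^-1` `]-oo, y])).
  by apply: measurableI; apply: measurable_digits => //; exact: measurable_itv.
by rewrite !setTI; apply/seteqP; split => u /=; rewrite !in_itv/=.
Qed.

(** Conditioning on the first two digits of [u], each of them fair and independent of
    the rest, gives the recursion of [digits_cdf] in each coordinate. *)
Lemma digits_joint n x y :
  unif01 [set u | digits false n u <= x /\ digits true n u <= y] =
  (digits_cdf n x * digits_cdf n y)%:E.
Proof.
elim: n x y => [|n IH] x y.
  rewrite /=; have [x0|x0] := leP 0 x; have [y0|y0] := leP 0 y; rewrite ?mulr0 ?mul0r ?mulr1.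
  - by rewrite (_ : [set _ | _] = setT) ?unif01_setT//; apply/seteqP; split.
  - by rewrite (_ : [set _ | _] = set0) ?measure0//; apply/seteqP; split => // u [].
  - by rewrite (_ : [set _ | _] = set0) ?measure0//; apply/seteqP; split => // u [].
  - by rewrite (_ : [set _ | _] = set0) ?measure0//; apply/seteqP; split => // u [].
have ms := @measurable_shift2 R.
(* [A i] is the event once the first digit is known to be [i], and [AA i j] once the
   first two digits are known to be [i] and [j]. *)
pose A (i : bool) := [set v : M | digits false n (shift2 v) <= 2 * x - i%:R /\
   ((digit v)%:R + digits true n (shift2 v)) / 2 <= y].
pose AA (i j : bool) := [set w : M | digits false n w <= 2 * x - i%:R /\ digits true n w <= 2 * y - j%:R].
have mAA i j : measurable (AA i j) by exact: measurable_digits_le.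
have AE i j : [set u | digit u = j] `&` A i = [set u | digit u = j] `&` shift2 @^-1` (AA i j).
  apply/seteqP; split => v [/= vj [h1 h2]]; split => //; rewrite /A/AA/= ?vj; split => //.
    by rewrite vj in h2; rewrite lerBrDl [2 * y]mulrC -ler_pdivrMr.
  by rewrite ler_pdivrMr// [y * 2]mulrC -lerBrDl.
have mA i : measurable (A i).
  rewrite (_ : A i = ([set u | digit u = false] `&` A i) `|` ([set u | digit u = true] `&` A i)).
    rewrite !AE; apply: measurableU; (apply: measurableI; first exact: measurable_digit_set);
    by rewrite -[X in measurable X]setTI; exact: ms.
  rewrite -setIUl (_ : _ `|` _ = setT) ?setTI//.
  by apply/seteqP; split => // u _ /=; case: (digit u); [right|left].
have BE i : [set u | digit u = i] `&` [set u | digits false n.+1 u <= x /\ digits true n.+1 u <= y] =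
    [set u | digit u = i] `&` shift2 @^-1` (A i).
  apply/seteqP; split => v [/= vi [h1 h2]]; split => //; rewrite /A/= ?vi; split => //.
    by rewrite vi in h1; rewrite lerBrDl [2 * x]mulrC -ler_pdivrMr.
  by rewrite ler_pdivrMr// [x * 2]mulrC -lerBrDl.
have Aval i : unif01 (A i) = ((digits_cdf n (2 * x - i%:R)) * digits_cdf n.+1 y)%:E.
  rewrite unif01_split// !AE !unif01_shift2// /AA !IH -!EFinM -EFinD; congr EFin.
  rewrite /= subr0; lra.
rewrite unif01_split; last exact: measurable_digits_le.
rewrite !BE !unif01_shift2// !Aval -!EFinM -EFinD; congr EFin.
rewrite mulr1n mulr0n subr0 [digits_cdf n.+1 x]/=.
by move: (digits_cdf n.+1 y) (digits_cdf n (2 * x)) (digits_cdf n (2 * x - 1)) => *; field.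
Qed.

End digits.

Section independent_uniforms.
Context {R : realType}.
Implicit Types (x y u : R) (o : bool) (n : nat).
Local Notation M := (measurableTypeR R).
Local Notation unif01 := (@unif01 R).

Let digits_nd o u : nondecreasing_seq (digits o ^~ u).
Proof. by apply/nondecreasing_seqP => n; exact: digits_ndS. Qed.

Let digits_cvg o u : cvgn (digits o ^~ u).
Proof.
apply: nondecreasing_is_cvgn => //.
by exists 1 => _ [n _ <-]; exact: digits_le1.
Qed.

Definition digits_lim o u : R := limn (digits o ^~ u).

Lemma digits_lim_leP o u x : digits_lim o u <= x <-> forall n, digits o n u <= x.
Proof.
split=> [h n|h]; last by apply: limr_le => //; exact: nearW.
by apply: le_trans h; exact: nondecreasing_cvgn_le.
Qed.

Lemma digits_lim_le1 o u : digits_lim o u <= 1.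
Proof. by apply/digits_lim_leP => n; exact: digits_le1. Qed.

Lemma measurable_digits_lim o : measurable_fun setT (digits_lim o : M -> M).
Proof.
apply: (@measurable_fun_cvg _ _ _ _ (fun n => digits o n : M -> R)).
  by move=> n; exact: measurable_digits.
by move=> u _; exact: digits_cvg.
Qed.

Let mpre o (S : set M) : measurable S -> measurable (digits_lim o @^-1` S).
Proof. by move=> mS; rewrite -[X in measurable X]setTI; exact: measurable_digits_lim. Qed.

Let joint_rays x y :
  unif01 (digits_lim true @^-1` `]-oo, y] `&` digits_lim false @^-1` `]-oo, x]) =
  ((clamp x)%:E * (clamp y)%:E)%E.
Proof.
pose F n := [set u : M | digits false n u <= x /\ digits true n u <= y].
have -> : digits_lim true @^-1` `]-oo, y] `&` digits_lim false @^-1` `]-oo, x] = \bigcap_n F n.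
  apply/seteqP; split => u /=; rewrite ?in_itv/=.
    by move=> [/digits_lim_leP hy /digits_lim_leP hx] n _; split.
  by move=> h; split; apply/digits_lim_leP => n; have [] := h n Logic.I.
have mF n : measurable (F n) by exact: measurable_digits_le.
have h1 : (unif01 \o F) n @[n --> \oo] --> unif01 (\bigcap_n F n).
  apply: nonincreasing_cvg_mu => //.
  - by apply: (@le_lt_trans _ _ 1%E); [exact: probability_le1|exact: ltry].
  - exact: bigcapT_measurable.
  - move=> m n mn; apply/subsetPset => u [hx hy]; split.
      by apply: le_trans hx; exact: digits_nd.
    by apply: le_trans hy; exact: digits_nd.
have h2 : (unif01 \o F) n @[n --> \oo] --> ((clamp x)%:E * (clamp y)%:E)%E.
  rewrite (_ : unif01 \o F = fun n => (digits_cdf n x * digits_cdf n y)%:E).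
    rewrite -EFinM; apply: cvg_EFin; first exact: nearW.
    by apply: cvgM; exact: digits_cdf_cvg.
  by apply/funext => n /=; exact: digits_joint.
exact: (cvg_unique _ h1 h2).
Qed.

Let clamp_ge0 x : 0 <= clamp x. Proof. by rewrite /clamp le_max lexx. Qed.

Let clamp1 : clamp (1 : R) = 1.
Proof. by rewrite /clamp minxx max_r. Qed.

Let ray1 o : digits_lim o @^-1` `]-oo, (1 : R)] = setT.
Proof. by apply/seteqP; split => // u _ /=; rewrite in_itv/= digits_lim_le1. Qed.

Let joint_ray (A : set M) y : measurable A ->
  unif01 (digits_lim true @^-1` `]-oo, y] `&` digits_lim false @^-1` A) =
  ((clamp y)%:E * unif01 A)%E.
Proof.
move=> mA; apply: preimage_eq_rays => //.
- exact: measurable_digits_lim.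
- by apply: mpre; exact: measurable_itv.
- by have := joint_rays 1 y; rewrite ray1 setIT clamp1 mul1e.
- by move=> x; apply: etrans (joint_rays x y) _;
    rewrite muleC; congr (_ * _)%E; apply/esym; exact: unif01_ray.
Qed.

(** The digits of odd rank and those of even rank form two independent uniform
    variables; the product formula for rays is extended one coordinate at a
    time. *)
Lemma unif01_digits_joint (A E : set M) : measurable A -> measurable E ->
  unif01 (digits_lim false @^-1` A `&` digits_lim true @^-1` E) =
  (unif01 A * unif01 E)%E.
Proof.
move=> mA mE.
have fA : unif01 A \is a fin_num by exact: fin_num_measure.
have mass : unif01 (digits_lim false @^-1` A) = (fine (unif01 A))%:E.
  by rewrite fineK//; have := joint_ray 1 mA; rewrite ray1 setTI clamp1 mul1e.
rewrite -[in RHS](fineK fA); apply: preimage_eq_rays => //.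
- exact: measurable_digits_lim.
- exact: mpre.
- by rewrite fine_ge0.
- move=> y; rewrite setIC; apply: etrans (joint_ray y mA) _.
  by rewrite fineK// muleC; congr (_ * _)%E; apply/esym; exact: unif01_ray.
Qed.

(** [digits_lim true] keeps half of the remaining digits in reserve, and
    [digits_lim false] uses the other half: the [i]-th variable uses one half of
    what the first [i] ones have left. *)
Definition unif_seq i u : R := digits_lim false (iter i (digits_lim true) u).

Lemma measurable_unif_seq i : measurable_fun setT (unif_seq i : M -> M).
Proof.
apply: (measurableT_comp (measurable_digits_lim false)).
elim: i => [|i IH]; first exact: measurable_id.
exact: (measurableT_comp (measurable_digits_lim true) IH).
Qed.

Lemma measurable_unif_seq_event n (A : nat -> set M) :
  (forall i, measurable (A i)) ->
  measurable [set u : M | forall i, (i < n)%N -> A i (unif_seq i u)].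
Proof.
move=> mA; rewrite (_ : [set _ | _] = \bigcap_(i in `I_n) (unif_seq i @^-1` A i)); last first.
  by apply/seteqP; split => u h i /=; exact: h.
apply: fin_bigcap_measurable => // i _.
by rewrite -[X in measurable X]setTI; exact: measurable_unif_seq.
Qed.

Lemma unif_seq_joint n (A : nat -> set M) : (forall i, measurable (A i)) ->
  unif01 [set u : M | forall i, (i < n)%N -> A i (unif_seq i u)] =
  (\prod_(i < n) unif01 (A i))%E.
Proof.
elim: n A => [|n IH] A mA.
  by rewrite big_ord0 (_ : [set _ | _] = setT) ?unif01_setT//; apply/seteqP; split.
pose E := [set u : M | forall i, (i < n)%N -> A i.+1 (unif_seq i u)].
have -> : [set u : M | forall i, (i < n.+1)%N -> A i (unif_seq i u)] =
    digits_lim false @^-1` A 0%N `&` digits_lim true @^-1` E.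
  apply/seteqP; split => u.
    move=> h; split; first exact: (h 0%N).
    by move=> i ik /=; have := h i.+1 ik; rewrite /unif_seq iterSr.
  move=> [h0 h] [_//|i ik]; have := h i ik.
  by rewrite /unif_seq iterSr.
rewrite unif01_digits_joint//; last exact: (@measurable_unif_seq_event n (fun i => A i.+1)).
by rewrite big_ord_recl /E (IH (fun i => A i.+1)).
Qed.

Lemma unif_seq_law i (A : set M) : measurable A ->
  unif01 (unif_seq i @^-1` A) = unif01 A.
Proof.
move=> mA; have := @unif_seq_joint i.+1 (fun k => if k == i then A else setT).
rewrite big_ord_recr/= eqxx big1 ?mul1e => [<-|k _].
- congr (unif01 _); apply/seteqP; split => u h; last by have := h i (ltnSn i); rewrite eqxx.
  by move=> k _; case: eqP => // ->.
- by move=> k; case: eqP.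
- by rewrite ltn_eqF// unif01_setT.
Qed.

End independent_uniforms.

(** * Variables obtained from uniform ones by quantiles *)

Section quantile_transforms.
Context {R : realType}.
Implicit Types (x s l u : R).
Local Notation M := (measurableTypeR R).
Local Notation unif01 := (@unif01 R).

Lemma clamp_id x : 0 <= x <= 1 -> clamp x = x.
Proof. by rewrite /clamp => /andP[x0 x1]; rewrite min_l// max_r. Qed.

Lemma unif01_interior (S : set M) : measurable S ->
  unif01 (S `&` `]0, 1[) = unif01 S.
Proof.
move=> mS.
have mI : measurable (`]0, 1[%classic : set M) by exact: measurable_itv.
have ray01 : unif01 (`]-oo, 0] : set M) = 0%E.
  by rewrite unif01_ray clamp_id ?lexx ?ler01.
have tail : unif01 (~` (`]-oo, 1] : set M)) = 0%E.
  rewrite probability_setC; last exact: measurable_itv.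
  by rewrite [X in (1 - X)%E](unif01_ray 1) clamp_id ?lexx ?ler01// subee.
have one : unif01 [set 1 : R] = 0%E.
  by rewrite /unif01/= /mrestr/= (_ : _ `&` _ = set0) ?measure0//; apply/seteqP; split => x //= [->]; rewrite in_itv/= ltxx andbF.
rewrite -[in RHS](setIT S) -(setUv (`]0, 1[%classic : set M)) setIUr measureU//; last 3 first.
- exact: measurableI.
- by apply: measurableI => //; exact: measurableC.
- by rewrite setIACA setICr setI0.
rewrite [X in (_ = _ + X)%E](_ : _ = 0%E) ?adde0//.
have nullU (C D : set M) : measurable C -> measurable D ->
    unif01 C = 0%E -> unif01 D = 0%E -> unif01 (C `|` D) = 0%E.
  by move=> mC mD C0 D0; rewrite measureU0.
have mray x : measurable (`]-oo, x]%classic : set M) by exact: measurable_itv.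
have m1 : measurable ([set 1] : set M) by exact: measurable_set1.
apply: (@subset_measure0 _ M R unif01 _ ((`]-oo, 0] `|` [set 1]) `|` ~` `]-oo, 1])).
- by apply: measurableI => //; exact: measurableC.
- by apply: measurableU; [exact: measurableU|exact: measurableC].
- move=> x /= [_ /negP]; rewrite !in_itv/= negb_and -!leNgt => /orP[x0|x1].
    by left; left.
  by case: (eqVneq x 1) => [->|xn]; [left; right|right; apply/negP; rewrite -ltNge lt_neqAle eq_sym xn].
- by apply: (nullU _ _) => //; [exact: measurableU|exact: measurableC|exact: nullU].
Qed.

Definition normal_transform u : R := (normal_quantile \_ (`]0, 1[%classic : set R)) u.

Lemma measurable_normal_transform : measurable_fun setT (normal_transform : M -> M).
Proof.
have mI : measurable (`]0, 1[%classic : set M) by exact: measurable_itv.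
apply: (@proj1 _ _ (measurable_restrictT (normal_quantile : M -> M) mI)) => //.
apply: (measurability (@RGenOInfty.G R)).
  exact: RGenOInfty.measurableE.
move=> _ [_ [x ->] <-].
rewrite (_ : _ `&` _ = `]0, 1[ `&` `]Phi x, +oo[); first by apply: measurableI => //; exact: measurable_itv.
apply/seteqP; split => u /=; rewrite !in_itv/= !andbT => -[u01].
  by move=> h; split => //; move: h; rewrite ltNge normal_quantile_le// -ltNge.
by move=> h; split => //; rewrite ltNge normal_quantile_le// -ltNge.
Qed.

Lemma normal_transform_law s (A : set M) : 0 < s -> measurable A ->
  unif01 ((fun u => s * normal_transform u) @^-1` A) = normal_prob 0 s A.
Proof.
move=> s0 mA.
have mf : measurable_fun setT (fun u : M => s * normal_transform u : M).
  by apply: measurable_funM; [exact: measurable_cst|exact: measurable_normal_transform].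
have mpre S : measurable S -> measurable ((fun u : M => s * normal_transform u : M) @^-1` S).
  by move=> mS; rewrite -[X in measurable X]setTI; exact: mf.
rewrite -(setTI (_ @^-1` A)) (preimage_eq_rays (Q := normal_prob 0 s) (c := 1)) ?mul1e//.
  exact: unif01_setT.
move=> x; rewrite setTI mul1e.
apply: etrans (esym (unif01_interior (mpre _ _))) _; first exact: measurable_itv.
have [y ->] : exists y, x = s * y by exists (x / s); rewrite mulrC divfK ?lt0r_neq0.
apply: etrans _ (esym (normal_prob_scale y s0)).
have P01 : 0 <= Phi y <= 1.
  rewrite /Phi fine_ge0 ?measure_ge0//= -lee_fin fineK ?probability_le1//.
  by apply: fin_num_measure; exact: measurable_itv.
have -> : normal_prob 0 1 (`]-oo, y]%classic : set R) = (Phi y)%:E by rewrite fineK// fin_num_measure.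
rewrite -[in RHS](clamp_id P01) -unif01_ray -[RHS]unif01_interior; last exact: measurable_itv.
congr (unif01 _); apply/seteqP; split => u /=; rewrite !in_itv/= => -[h u01]; split => //.
  by move: h; rewrite ler_pM2l// /normal_transform patchE mem_set//= normal_quantile_le.
by rewrite ler_pM2l// /normal_transform patchE mem_set//= normal_quantile_le.
Qed.

Definition poisson_transform l u : nat := if u < 1 then poisson_quantile l u else 0%N.

(** The Galois connection makes the sublevel sets of the quantile rays, up to the null
    set where [u >= 1]. *)
Lemma poisson_transform_le l n : 0 < l ->
  [set u : M | (poisson_transform l u <= n)%N] = `]-oo, poisson_cdf n l] `|` `[1, +oo[.
Proof.
move=> l0; apply/seteqP; split => u /=; rewrite !in_itv/= andbT /poisson_transform.
  by case: ltP => u1; [rewrite poisson_quantile_le//; left|right].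
case: ltP => u1; last by [].
by rewrite poisson_quantile_le// => -[].
Qed.

Lemma measurable_poisson_transform l m : 0 < l ->
  measurable [set u : M | poisson_transform l u = m].
Proof.
move=> l0.
have mle n : measurable [set u : M | (poisson_transform l u <= n)%N].
  by rewrite poisson_transform_le//; apply: measurableU; exact: measurable_itv.
case: m => [|m].
  rewrite (_ : [set _ | _] = [set u : M | (poisson_transform l u <= 0)%N])//.
  by apply/seteqP; split => u /=; lia.
rewrite (_ : [set _ | _] = [set u : M | (poisson_transform l u <= m.+1)%N] `\`
    [set u : M | (poisson_transform l u <= m)%N]); first exact: measurableD.
by apply/seteqP; split => u /=; [move=> ->; split=> //|move=> [h /negP]]; lia.
Qed.

Lemma unif01_poisson_transform l m : 0 < l ->
  unif01 [set u : M | poisson_transform l u = m] = (poisson_pmf l m)%:E.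
Proof.
move=> l0.
have mle n : measurable [set u : M | (poisson_transform l u <= n)%N].
  by rewrite poisson_transform_le//; apply: measurableU; exact: measurable_itv.
have cdf1 n : 0 <= poisson_cdf n l <= 1.
  rewrite poisson_cdfE//; apply/andP; split; first by apply: sumr_ge0 => k _; exact: poisson_pmf_ge0.
  rewrite -lee_fin -(poisson_pmf_sum1 l0) -sumEFin.
  rewrite -(big_mkord xpredT (fun k => (poisson_pmf l k)%:E)).
  by apply: nneseries_lim_ge => k _ _; rewrite lee_fin poisson_pmf_ge0.
have le n : unif01 [set u : M | (poisson_transform l u <= n)%N] = (poisson_cdf n l)%:E.
  rewrite -unif01_interior// -[in RHS](clamp_id (cdf1 n)) -unif01_ray -[RHS]unif01_interior; last exact: measurable_itv.
  congr (unif01 _); rewrite poisson_transform_le//.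
  apply/seteqP; split => u /=; rewrite !in_itv/= andbT => -[h /andP[u0 u1]]; split; rewrite ?u0 ?u1//.
    by case: h => // /le_lt_trans /(_ u1); rewrite ltxx.
  by left.
case: m => [|m].
  have := le 0%N; rewrite poisson_cdfE// big_ord_recl big_ord0 addr0 => <-.
  by congr (unif01 _); apply/seteqP; split => u /=; lia.
have := le m.+1; rewrite poisson_cdfE// big_ord_recr/= -poisson_cdfE// EFinD -le.
rewrite (_ : [set u : M | (poisson_transform l u <= m.+1)%N] =
  [set u : M | (poisson_transform l u <= m)%N] `|` [set u : M | poisson_transform l u = m.+1]); last first.
  by apply/seteqP; split => u /=; [rewrite leq_eqVlt => /orP[/eqP|]; [right|left]|case; lia].
set A := [set u : M | _]; set C := [set u : M | _].
have mC : measurable C by exact: measurable_poisson_transform.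
have AC : A `&` C = set0 by apply/seteqP; split => u //= -[]; rewrite /A/C/=; lia.
have addAC : unif01 (A `|` C) = (unif01 A + unif01 C)%E by exact: measureU (mle m) mC AC.
rewrite [X in X = _ -> _]addAC le -(@fineK _ (unif01 C)) ?fin_num_measure//.
by rewrite -EFinD => -[] e; congr EFin; exact: (addrI (poisson_cdf m l)) e.
Qed.

End quantile_transforms.

(** * Convergence in law by coupling of discrete vectors *)

Section discrete_vectors.
Context {R : realType} {k : nat}.

(** Encoding the first [k] counts as an integer reduces statements on random vectors
    to statements on measures on a countable set. *)
Definition vector_code (a : nat -> nat) : nat := choice.pickle (mkseq a k).

Definition vector_decode (c : nat) : nat -> nat := nth 0%N (odflt [::] (choice.unpickle c)).

Lemma vector_decodeE a i : (i < k)%N -> vector_decode (vector_code a) i = a i.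
Proof. by move=> ik; rewrite /vector_decode /vector_code choice.pickleK/= nth_mkseq. Qed.

Lemma vector_code_eq a b : vector_code a = vector_code b <-> forall i, (i < k)%N -> a i = b i.
Proof.
split=> [ab i ik|ab]; first by rewrite -(vector_decodeE _ ik) ab vector_decodeE.
by congr choice.pickle; apply/eq_in_map => i; rewrite mem_iota/= add0n; exact: ab.
Qed.

Definition vector_event (T : Type) (N : T -> nat -> nat) (b : nat -> nat) :=
  [set w | forall i, (i < k)%N -> N w i = b i].

Lemma vector_code_fiber c :
  (forall (T : Type) (N : T -> nat -> nat), (fun w => vector_code (N w)) @^-1` [set c] = set0) \/
  (exists b, forall (T : Type) (N : T -> nat -> nat),
    (fun w => vector_code (N w)) @^-1` [set c] = vector_event N b).
Proof.
case: (pselect (exists b, vector_code b = c)) => [[b <-]|/forallNP h].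
  by right; exists b => T N; apply/seteqP; split => w /= /vector_code_eq.
by left => T N; apply/seteqP; split => w //= /h.
Qed.

Let bigcup_points (S : set nat) : \bigcup_(c in S) [set c] = S.
Proof. by apply/seteqP; split => [c [_ Sc ->]//|c Sc]; exists c. Qed.

Lemma measurable_vector_code d (T : measurableType d) (N : T -> nat -> nat) :
  (forall b, measurable (vector_event N b)) ->
  measurable_fun setT (fun w => vector_code (N w)).
Proof.
move=> mN _ S _; rewrite setTI -(bigcup_points S) preimage_bigcup.
apply: bigcup_measurable => c _.
by have [->|[b ->]] := vector_code_fiber c; [exact: measurable0|exact: mN].
Qed.

Lemma measurable_vector_event d (T : measurableType d) (N : T -> nat -> nat)
    (A : set (nat -> nat)) :
  (forall b, measurable (vector_event N b)) ->
  (forall a b, (forall i, (i < k)%N -> a i = b i) -> A a -> A b) ->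
  measurable [set w | A (N w)].
Proof.
move=> mN Ak; rewrite (_ : [set _ | _] =
    (fun w => vector_code (N w)) @^-1` [set c | A (vector_decode c)]).
  by rewrite -[X in measurable X]setTI; exact: measurable_vector_code.
by apply/seteqP; split => w /=; apply: Ak => i ik; rewrite vector_decodeE.
Qed.

(** The law of a vector of integers is determined by the probabilities of its
    countably many values. *)
Lemma expectation_eq_vector d1 (T1 : measurableType d1) (P1 : probability T1 R)
    d2 (T2 : measurableType d2) (P2 : probability T2 R)
    (N1 : T1 -> nat -> nat) (N2 : T2 -> nat -> nat) (G : (nat -> nat) -> R) (C : R) :
  (forall b, measurable (vector_event N1 b)) ->
  (forall b, measurable (vector_event N2 b)) ->
  (forall b, P1 (vector_event N1 b) = P2 (vector_event N2 b)) ->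
  (forall a b, (forall i, (i < k)%N -> a i = b i) -> G a = G b) ->
  (forall a, `|G a| <= C) ->
  ('E_P1[fun w => G (N1 w)] = 'E_P2[fun w => G (N2 w)])%E.
Proof.
move=> mN1 mN2 PN Gk GC.
have E d (T : measurableType d) (P : probability T R) (N : T -> nat -> nat) :
    (forall b, measurable (vector_event N b)) ->
    ('E_P[fun w => G (N w)] =
      \int[pushforward P (fun w => vector_code (N w))]_c (G (vector_decode c))%:E)%E.
  move=> mN; have mc := measurable_vector_code mN.
  rewrite (integral_pushforward mc) //=; last first.
    rewrite preimage_setT.
    apply: (@measurable_bounded_integrable _ _ _ P (fun w => G (vector_decode (vector_code (N w))))) => //.
    - by rewrite /= (@probability_setT _ _ _ P) ltry.
    - exact: (measurableT_comp (f := fun c => G (vector_decode c)) _ mc).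
    - exists C; split; rewrite ?num_real// => M CM x _ /=.
      by apply: (le_trans (GC _)); exact: ltW.
  rewrite unlock preimage_setT; apply: eq_integral => w _ /=.
  by congr EFin; apply: Gk => i ik; rewrite vector_decodeE.
rewrite (E _ _ _ _ mN1) (E _ _ _ _ mN2).
have mc1 := measurable_vector_code mN1; have mc2 := measurable_vector_code mN2.
apply: eq_measure_integral => S _ _.
have sum d (T : measurableType d) (P : probability T R) (N : T -> nat -> nat) :
    measurable_fun setT (fun w => vector_code (N w)) ->
    pushforward P (fun w => vector_code (N w)) S =
    (\sum_(c <oo | c \in S) P ((fun w => vector_code (N w)) @^-1` [set c]))%E.
  move=> mc; rewrite -{1}(bigcup_points S) /pushforward preimage_bigcup measure_bigcup//.
  - by move=> c _; rewrite -[X in measurable X]setTI; exact: mc.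
  - by apply: trivIset_preimage1.
transitivity (pushforward P1 (fun w => vector_code (N1 w)) S) => //; rewrite sum//.
transitivity (pushforward P2 (fun w => vector_code (N2 w)) S) => //; rewrite sum//; apply: eq_eseriesr => c _.
by have [h|[b h]] := vector_code_fiber c; rewrite !h ?measure0.
Qed.

End discrete_vectors.

Section row_vectors.
Context {R : realType} {k : nat}.

Lemma cvg_row (v : nat -> nat -> R) (l : nat -> R) :
  (forall i, (i < k)%N -> v n i @[n --> \oo] --> l i) ->
  (\row_(i < k) v n i : 'rV[R]_k) @[n --> \oo] --> (\row_(i < k) l i : 'rV[R]_k).
Proof.
move=> vl; apply/cvg_ballP => e e0.
have : \forall n \near \oo, forall i : 'I_k, ball (l i) e (v n i).
  by apply: filter_forall => i; move/cvg_ballP: (vl i (ltn_ord i)); exact.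
by apply: filterS => n h; split => // i j; rewrite !mxE.
Qed.

(** An open set of row vectors is the union of the countably many boxes of rational
    centre that it contains, with sides [2 / (m + 1)]. *)
Lemma row_random_element d (T : measurableType d) (V : nat -> T -> R) :
  (forall i, measurable_fun setT (V i)) ->
  random_element (fun w => \row_(i < k) V i w : 'rV[R]_k).
Proof.
move=> mV U oU.
pose box (q : 'rV[rat]_k) (m : nat) := [set y : 'rV[R]_k | forall i, `|ratr (q 0 i) - y 0 i| < m.+1%:R^-1].
pose A (qm : 'rV[rat]_k * nat) : set T :=
  if `[< box qm.1 qm.2 `<=` U >]
  then [set w | forall i : 'I_k, `|ratr (qm.1 0 i) - V i w| < qm.2.+1%:R^-1] else set0.
rewrite (_ : _ @^-1` U = \bigcup_qm A qm); last first.
  apply/seteqP; split => w /=; last first.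
    move=> [[q m] _]; rewrite /A/=; case: asboolP => // bU h.
    by apply: bU => i; rewrite mxE; exact: h.
  move=> Uw; have /nbhs_ballP[e /= e0 eU] : nbhs (\row_(i < k) V i w : 'rV[R]_k) U.
    exact: open_nbhs_nbhs.
  have [m me] : exists m : nat, m.+1%:R^-1 *+ 2 < e.
    have [m hm] : exists m, 0 + m.+1%:R^-1 < e / 2 by apply: ltr_add_invr; rewrite divr_gt0.
    by exists m; rewrite add0r in hm; rewrite mulr2n (splitr e) ltrD.
  have /choice[q hq] (i : 'I_k) : exists q : rat, `|ratr q - V i w| < m.+1%:R^-1.
    have /rat_in_itvoo[q] : V i w < V i w + m.+1%:R^-1 by rewrite ltrDl.
    by rewrite in_itv/= => /andP[h1 h2]; exists q; rewrite ltr_norml ltrBlDl h2 andbT; apply: (@lt_trans _ _ 0); rewrite ?oppr_lt0 ?subr_gt0.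
  exists (\row_i q i, m) => //; rewrite /A/=; case: asboolP => [_ i|]; first by rewrite mxE.
  case=> y hy; apply: eU; split => // i j; rewrite !mxE ord1 /ball/=.
  have := hy j; rewrite mxE => yj.
  apply: le_lt_trans me; rewrite -(subrKA (ratr (q j))) mulr2n.
  by apply: (le_trans (ler_normD _ _)); rewrite lerD ?ltW// distrC.
apply: countable_bigcupT_measurable => //.
move=> [q m]; rewrite /A/=; case: asboolP => // _.
rewrite (_ : [set _ | _] = \bigcap_(i in [set: 'I_k]) ((fun w => ratr (q 0 i) - V i w) @^-1` (ball_ Num.norm 0 m.+1%:R^-1))); last first.
  by apply/seteqP; split => w h i /=; [move=> _; rewrite sub0r normrN|have := h i Logic.I; rewrite /= sub0r normrN].
apply: fin_bigcap_measurable => // i _.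
rewrite -[X in measurable X]setTI; apply: measurable_funB => //.
exact: (measurable_ball 0 m.+1%:R^-1).
Qed.

End row_vectors.

Section weak_convergence_by_coupling.
Context {R : realType} {d : measure_display} {T : measurableType d} (P : probability T R)
  {d' : measure_display} {T' : measurableType d'} (P' : probability T' R)
  {E : topologicalType} {k : nat}.

Lemma random_element_comp (V : T' -> E) (f : E -> R) :
  random_element V -> continuous f -> measurable_fun setT (f \o V).
Proof.
move=> rV cf; apply: (measurability (@RGenOpens.G R)).
  exact: RGenOpens.measurableE.
move=> _ [_ [a [b ->]] <-]; rewrite setTI comp_preimage; apply: rV.
by apply: open_comp => // x _; exact: cf.
Qed.

(** Convergence in law involves only the law of each term, so [N n] may be replaced by
    any [N' n] of the same law.  If these are all defined on one space and the
    rescaled vectors converge there almost surely, bounded convergence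
    concludes. *)
Lemma cvg_in_law_coupling (N : nat -> T -> nat -> nat) (N' : nat -> T' -> nat -> nat)
    (g : nat -> (nat -> nat) -> E) (V' : T' -> E) (D : set T') :
  (forall n b, measurable (vector_event (k := k) (N n) b)) ->
  (forall n b, measurable (vector_event (k := k) (N' n) b)) ->
  (forall n b, P (vector_event (k := k) (N n) b) = P' (vector_event (k := k) (N' n) b)) ->
  (forall n a b, (forall i, (i < k)%N -> a i = b i) -> g n a = g n b) ->
  random_element V' -> measurable D -> P' (~` D) = 0%E ->
  (forall w, D w -> g n (N' n w) @[n --> \oo] --> V' w) ->
  cvg_in_law P P' (fun n w => g n (N n w)) V'.
Proof.
move=> mN mN' NN' gk rV' mD D0 cvg_g; split=> // [n U _|f cf [C fC]].
  apply: (measurable_vector_event (A := [set a | U (g n a)]) (mN n)) => a b ab /=.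
  by rewrite (gk n a b ab).
have -> : (fun n => 'E_P[f \o (fun w => g n (N n w))])%E =
    (fun n => 'E_P'[f \o (fun w => g n (N' n w))])%E.
  apply/funext => n.
  apply: (expectation_eq_vector (G := f \o g n) (C := C) (mN n) (mN' n)) => [||a] //=.
  by move=> a b ab /=; rewrite (gk n a b ab).
rewrite unlock.
have mf n : measurable_fun setT (f \o (fun w => g n (N' n w))).
  move=> _ S mS; rewrite setTI.
  apply: (measurable_vector_event (A := [set a | S (f (g n a))]) (mN' n)) => a b ab /=.
  by rewrite (gk n a b ab).
have := @dominated_convergence _ _ _ P' setT measurableT
  (fun n w => (f (g n (N' n w)))%:E) (fun w => (f (V' w))%:E) (fun=> C%:E).
case.
- by move=> n; apply/measurable_EFinP; exact: mf.
- by apply/measurable_EFinP; exact: random_element_comp.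
- exists (~` D); split => //; first exact: measurableC.
  move=> w /= h Dw; apply: h => _.
  apply: cvg_EFin; first exact: nearW.
  exact: (@cvg_comp _ _ _ (fun n => g n (N' n w)) f _ _ _ (cvg_g w Dw) (cf (V' w))).
- by apply: finite_measure_integrable_cst.
- by apply: aeW => w n _; rewrite lee_fin.
- by move=> _ _.
Qed.

End weak_convergence_by_coupling.

(** * Joint limit of the counts *)

Section gaussian_sequence.
Context {R : realType}.
Variable s : nat -> R.
Local Notation M := (measurableTypeR R).

Definition gaussian_seq j (u : M) : R := s j * normal_transform (unif_seq j u).

Lemma measurable_gaussian_seq j : measurable_fun setT (gaussian_seq j).
Proof.
apply: measurable_funM; first exact: measurable_cst.
exact: (measurableT_comp measurable_normal_transform (measurable_unif_seq j)).
Qed.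

HB.instance Definition _ j :=
  @isMeasurableFun.Build _ _ M R (gaussian_seq j) (measurable_gaussian_seq j).

Let transform j (v : M) : M := s j * normal_transform v.

Let measurable_transform j (A : set M) : measurable A -> measurable (transform j @^-1` A).
Proof.
move=> mA; rewrite -[X in measurable X]setTI.
have : measurable_fun setT (transform j).
  by apply: measurable_funM; [exact: measurable_cst|exact: measurable_normal_transform].
exact.
Qed.

Lemma gaussian_seq_law j (A : set M) : 0 < s j -> measurable A ->
  unif01 (gaussian_seq j @^-1` A) = normal_prob 0 (s j) A.
Proof.
move=> sj mA; rewrite -(normal_transform_law sj mA).
exact: (unif_seq_law j (measurable_transform j mA)).
Qed.

(** Distinct coordinates are functions of distinct independent uniform variables. *)
Lemma gaussian_seq_independent (I : set nat) :
  mutually_independent (unif01 : probability M R) I gaussian_seq.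
Proof.
move=> J A _ mA.
pose n := (\max_(j <- J) j)%N.+1.
pose C j : set M := if j \in J then transform j @^-1` A j else setT.
have mC j : measurable (C j).
  by rewrite /C; case: ifP => [_|_]; [exact: (measurable_transform j (mA j))|exact: measurableT].
have Jn j : j \in J -> (j < n)%N.
  by move=> jJ; rewrite ltnS /n big_seq; apply: (@leq_bigmax_seq _ (enum_fset J) (mem J) (fun j => j)) => //.
have -> : \bigcap_(j in [set` J]) gaussian_seq j @^-1` A j =
    [set u : M | forall j, (j < n)%N -> C j (unif_seq j u)].
  apply/seteqP; split => u h j; last by move=> /= jJ; have := h j (Jn j jJ); rewrite /C jJ.
  by move=> _; rewrite /C; case: ifP => // jJ; exact: (h j jJ).
rewrite [LHS]unif_seq_joint// -(big_mkord xpredT (fun j => unif01 (C j))) /index_iota subn0.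
under eq_bigr => j _.
  rewrite (_ : unif01 (C j) = if j \in J then unif01 (gaussian_seq j @^-1` A j) else 1%E); last first.
    rewrite /C; case: ifP => _; last exact: unif01_setT.
    exact: (esym (unif_seq_law j (measurable_transform j (mA j)))).
  over.
rewrite -big_mkcond -big_filter; apply: perm_big; apply: uniq_perm.
- by rewrite filter_uniq// iota_uniq.
- exact: fset_uniq.
- move=> j; rewrite mem_filter mem_iota add0n.
  by case jJ : (j \in J); rewrite //= Jn.
Qed.

End gaussian_sequence.

Section poisson_scaling.
Context {R : realType}.

(** The variance of a Poisson variable of mean [c * r n] is [c] times the square of
    the normalization, whence the factor [sqrt c]. *)
Lemma poisson_transform_cvg (r : nat -> R) (c v : R) :
  (forall n, 0 < r n) -> r n @[n --> \oo] --> +oo -> 0 < c -> 0 < v < 1 ->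
  (Num.sqrt (r n))^-1 * ((poisson_transform (c * r n) v)%:R - c * r n) @[n --> \oo] -->
  Num.sqrt c * normal_transform v.
Proof.
move=> r0 ry c0 v01.
have lam0 n : 0 < c * r n by rewrite mulr_gt0.
have lamy : c * r n @[n --> \oo] --> +oo.
  apply/cvgryPge => A; move/cvgryPge: ry => /(_ (A / c)).
  by apply: filterS => n; rewrite ler_pdivrMr// mulrC.
have := @poisson_quantile_cvg R (fun n => c * r n) v lam0 lamy v01.
have -> : normal_transform v = normal_quantile v by rewrite /normal_transform patchE mem_set.
move=> h.
have {}h : Num.sqrt c * (((poisson_quantile (c * r n) v)%:R - c * r n) / Num.sqrt (c * r n))
    @[n --> \oo] --> Num.sqrt c * normal_quantile v.
  by apply: cvgM h; exact: cvg_cst.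
apply: (cvg_trans _ h); apply: near_eq_cvg; near=> n => /=.
have /andP[_ v1] := v01; rewrite /poisson_transform v1 sqrtrM ?(ltW c0)//.
have c1 : Num.sqrt c != 0 by rewrite lt0r_neq0// sqrtr_gt0.
have r1 : Num.sqrt (r n) != 0 by rewrite lt0r_neq0// sqrtr_gt0.
by field; rewrite c1 r1.
Unshelve. all: by end_near. Qed.

End poisson_scaling.

Section crp_coupling.
Context {R : realType} {X : polishType R} {d : measure_display}
  {T : measurableType d} (P : probability T R).
Variables (rho : lfmeasure X) (Y : R -> T -> pmeasure X).
Hypothesis rho_infinite : rho setT = +oo%E.
Hypothesis rho_diffuse : forall x, rho [set x] = 0%E.
Hypothesis Y_scrp : spatial_crp P rho Y.
Variable B : nat -> set X.
Hypothesis mB : forall n, measurable (B n : set (borel X)).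
Hypothesis bB : forall n, metric_bounded (B n).
Hypothesis B_nd : forall m n, (m <= n)%N -> B m `<=` B n.
Hypothesis B_exh : \bigcup_n B n = setT.
Hypothesis rhoB : forall n, (0 < rho (B n))%E.
Variable t : R.
Hypothesis t01 : 0 < t < 1.
Local Notation M := (measurableTypeR R).

Let r n := fine (rho (B n)).

Let rhoE n : rho (B n) = (r n)%:E.
Proof. by rewrite fineK// ge0_fin_numE// lfm_locally_finite. Qed.

Let r_gt0 n : 0 < r n. Proof. by rewrite -lte_fin -rhoE. Qed.

Let r_cvgy : r n @[n --> \oo] --> +oo.
Proof.
have h : (rho \o (B : nat -> set (borel X))) n @[n --> \oo] --> rho (\bigcup_n B n).
  apply: nondecreasing_cvg_mu => //; first by rewrite B_exh; exact: measurableT.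
  by move=> m n mn; apply/subsetPset; exact: B_nd.
rewrite B_exh rho_infinite in h.
apply/cvgeryP; apply: (cvg_trans _ h); apply: near_eq_cvg; near=> n.
by rewrite /= rhoE.
Unshelve. all: by end_near. Qed.

Let c i : R := t ^+ i / i%:R.

Let c_gt0 i : (0 < i)%N -> 0 < c i.
Proof. by move=> i0; have /andP[t0 _] := t01; rewrite divr_gt0 ?exprn_gt0// ltr0n. Qed.

Let lam_gt0 n i : 0 < c i.+1 * r n.
Proof. by rewrite mulr_gt0// c_gt0. Qed.

Let crp_counts n w i := multiplicity_count (Y t w) (B n) i.+1.

(* Poisson variables with the law of the counts, for all [n] functions of the same
   uniform variables. *)
Let coupled_counts n (u : M) i := poisson_transform (c i.+1 * r n) (unif_seq i.+1 u).

Let rescale n i (a : nat) : R := (Num.sqrt (r n))^-1 * (a%:R - c i.+1 * r n).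

Let normalized_countE n w i :
  normalized_count rho Y (B n) t i.+1 w = rescale n i (crp_counts n w i).
Proof. by rewrite /normalized_count /rescale /c mulrAC. Qed.

Let measurable_crp_event k n b : measurable (vector_event (k := k) (crp_counts n) b).
Proof.
rewrite (_ : vector_event _ _ = \bigcap_(i in `I_k)
    [set w | multiplicity_count (Y t w) (B n) i.+1 = b i]).
  by apply: fin_bigcap_measurable => // i _; exact: (measurable_crp_count Y_scrp).
by apply/seteqP; split => w h i /=; exact: h.
Qed.

(* The uniform variable attached to a count is numbered by the multiplicity, from 1
   on. *)
Let quantile_event n (b : nat -> nat) i : set M :=
  if i is i'.+1 then [set v | poisson_transform (c i'.+1 * r n) v = b i'] else setT.

Let measurable_quantile_event n b i : measurable (quantile_event n b i).
Proof. by case: i => [|i] //=; exact: measurable_poisson_transform. Qed.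

Let coupled_eventE k n b : vector_event (k := k) (coupled_counts n) b =
  [set u : M | forall i, (i < k.+1)%N -> quantile_event n b i (unif_seq i u)].
Proof.
apply/seteqP; split => u h; first by move=> [|i]//=; exact: h.
by move=> i ik; exact: (h i.+1).
Qed.

Let measurable_coupled_event k n b : measurable (vector_event (k := k) (coupled_counts n) b).
Proof. by rewrite coupled_eventE; apply: measurable_unif_seq_event. Qed.

Let same_law k n b : P (vector_event (k := k) (crp_counts n) b) =
  unif01 (vector_event (k := k) (coupled_counts n) b).
Proof.
rewrite coupled_eventE [RHS]unif_seq_joint//.
rewrite [LHS](crp_count_law rho_diffuse Y_scrp t01 (mB n) (bB n) (rhoB n) k b).
rewrite big_ord_recl/= unif01_setT mul1e -prodEFin; apply: eq_bigr => i _.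
by rewrite unif01_poisson_transform// /c mulrAC.
Qed.

Let gaussian : nat -> M -> R := gaussian_seq (fun j => Num.sqrt (c j)).

(* The quantiles converge where the uniform variables avoid 0 and 1. *)
Let good k := [set u : M | forall i, (i < k.+1)%N -> 0 < unif_seq i u < 1].

Let good_set (i : nat) : set M := [set v | 0 < v < 1].

Let measurable_good_set i : measurable (good_set i).
Proof.
rewrite (_ : good_set i = `]0, 1[%classic); first exact: measurable_itv.
by apply/seteqP; split => v /=; rewrite in_itv.
Qed.

Let measurable_good k : measurable (good k).
Proof. exact: (measurable_unif_seq_event k.+1 measurable_good_set). Qed.

Let good_full k : unif01 (~` good k) = 0%E.
Proof.
apply: etrans (probability_setC _ (measurable_good k)) _.
rewrite [X in (1 - X)%E](unif_seq_joint k.+1 measurable_good_set) big1 ?subee// => i _.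
rewrite -(unif01_setT (R := R)) -[RHS]unif01_interior// setTI.
by congr (unif01 _); apply/seteqP; split => v /=; rewrite in_itv.
Qed.

Let coupled_cvg k u i : good k u -> (i < k)%N ->
  rescale n i (coupled_counts n u i) @[n --> \oo] --> gaussian i.+1 u.
Proof.
by move=> gu ik; apply: poisson_transform_cvg => //; [exact: c_gt0|exact: (gu i.+1)].
Qed.

Lemma crp_cvg_row k : cvg_in_law P (unif01 : probability M R)
  (fun n w => \row_(i < k) normalized_count rho Y (B n) t i.+1 w : 'rV[R]_k)
  (fun u => \row_(i < k) gaussian i.+1 u : 'rV[R]_k).
Proof.
have -> : (fun n w => \row_(i < k) normalized_count rho Y (B n) t i.+1 w : 'rV[R]_k) =
    (fun n w => (fun n (a : nat -> nat) => \row_(i < k) rescale n i (a i) : 'rV[R]_k) n (crp_counts n w)).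
  by apply/funext => n; apply/funext => w; apply/rowP => i; rewrite !mxE normalized_countE.
apply: (cvg_in_law_coupling (k := k) (N' := coupled_counts) (D := good k)
  (g := fun n (a : nat -> nat) => \row_(i < k) rescale n i (a i) : 'rV[R]_k)) => //.
- by move=> n a b ab; apply/rowP => i; rewrite !mxE ab.
- apply: (row_random_element (V := fun i u => gaussian i.+1 u)) => i; exact: measurable_gaussian_seq.
- exact: good_full.
- move=> u gu; apply: (@cvg_row R k (fun n i => rescale n i (coupled_counts n u i))
    (fun i => gaussian i.+1 u)) => i ik; exact: coupled_cvg gu ik.
Qed.

Lemma crp_cvg_coordinate j : (0 < j)%N ->
  cvg_in_law P (unif01 : probability M R)
    (fun n => normalized_count rho Y (B n) t j) (gaussian j).
Proof.
case: j => // j _.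
have -> : (fun n => normalized_count rho Y (B n) t j.+1) =
    (fun n w => (fun n (a : nat -> nat) => rescale n j (a j)) n (crp_counts n w)).
  by apply/funext => n; apply/funext => w; rewrite normalized_countE.
apply: (cvg_in_law_coupling (k := j.+1) (N' := coupled_counts) (D := good j.+1)
  (g := fun n (a : nat -> nat) => rescale n j (a j))) => //.
- by move=> n a b ab; rewrite ab.
- move=> U oU; rewrite -[X in measurable X]setTI.
  by apply: measurable_gaussian_seq => //; exact: open_measurable.
- exact: good_full.
- by move=> u gu; exact: (coupled_cvg gu).
Qed.

End crp_coupling.

Theorem lemma6p1 (R : realType) (X : polishType R)
    (d : measure_display) (T : measurableType d) (P : probability T R)
    (rho : lfmeasure X)
    (rho_infinite : rho setT = +oo%E)
    (rho_diffuse : forall x : X, rho [set x] = 0%E)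
    (Y : R -> T -> pmeasure X)
    (Y_scrp : spatial_crp P rho Y)
    (B : nat -> set X)
    (B_measurable : forall n, measurable (B n : set (borel X)))
    (B_bounded : forall n, metric_bounded (B n))
    (B_increasing : forall m n, (m <= n)%N -> B m `<=` B n)
    (B_exhausts : \bigcup_n B n = setT)
    (rhoB_gt0 : forall n, (0 < rho (B n))%E)
    (t : R) (t01 : 0 < t < 1) :
  exists (d' : measure_display) (T' : measurableType d')
         (P' : probability T' R) (Z : nat -> {RV P' >-> R}),
    [/\ forall j : nat, (0 < j)%N ->
          cvg_in_law P P' (fun n => normalized_count rho Y (B n) t j) (Z j) /\
          (forall A : set R, measurable A ->
             distribution P' (Z j) A =
             normal_prob 0 (Num.sqrt (t ^+ j / j%:R)) A),
        forall k : nat,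
          cvg_in_law P P'
            (fun n w => \row_(i < k) normalized_count rho Y (B n) t i.+1 w
                        : 'rV[R]_k)
            (fun w => \row_(i < k) Z i.+1 w : 'rV[R]_k) &
        mutually_independent P' [set j | (0 < j)%N] (fun j => Z j : T' -> R)].
Proof.
pose s j := Num.sqrt (t ^+ j / j%:R) : R.
exists _, (measurableTypeR R), (unif01 : probability _ R),
  (fun j => gaussian_seq s j : {RV unif01 >-> R}).
split.
- move=> j j0; split; first exact: crp_cvg_coordinate.
  move=> A mA; have sj : 0 < s j.
    by have /andP[t0 _] := t01; rewrite sqrtr_gt0 divr_gt0 ?exprn_gt0// ltr0n.
  exact: (gaussian_seq_law (s := s) sj mA).
- by move=> k; exact: crp_cvg_row.
- exact: gaussian_seq_independent.
Qed.
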